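(* There exists a constant $C<\infty$ such that for every $0<u<1/4$ and every $0\le R<\infty$, the particle process $\zeta$ with parameter $u$ satisfies $$\sum_{n=1}^\infty \mathbb{E}[X^n_{[0,R]}]<C\,\frac{e^{4uR}}{1-4u}<\infty .$$ Furthermore, for every $u>1/4$ and every $0<R<\infty$, $$\lim_{n\to\infty}\mathbb{E}[X^n_{[0,R]}]=\infty .$$
   Context: For $u>0$ the particle process $\zeta=(\zeta^n)_{n\ge 1}$ on $\mathbb{R}^+=[0,\infty)$ is defined as follows. Let $\xi_0,(\xi_{k,n})_{k,n\ge 1}$ be i.i.d. Poisson point processes on $\mathbb{R}$ with intensity measure $u e^{\min(0,x)}\,dx$. Generation $0$ consists of a single particle at $0$. Generation $1$ is $\zeta^1=\{x\in\xi_0: x\ge 0\}$. Given generation $n\ge 1$, with points enumerated in increasing order $Z_{1,n}<Z_{2,n}<\cdots$, the offspring of $Z_{k,n}$ are $\zeta^{k,n+1}=\{x+Z_{k,n}: x\in\xi_{k,n},\ x+Z_{k,n}\ge 0\}$, and generation $n+1$ is $\zeta^{n+1}=\bigcup_{k\ge 1}\zeta^{k,n+1}$. Equivalently, each particle at position (type) $x\ge 0$ independently produces offspring in the next generation according to a Poisson process on $[0,\infty)$ with intensity measure $d\mu_x(y)=\mathbf{1}_{\{y\ge 0\}}\,u e^{-(x-y)^+}\,dy$, where $(x-y)^+=\max(0,x-y)$. $X^n_{[a,b]}=\sum_{k\ge 1}\mathbf{1}\{Z_{k,n}\in[a,b]\}$ is the number of generation-$n$ particles in $[a,b]$. *)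

(* Defs.v *)
From HB Require Import structures.
From mathcomp Require Import all_boot all_order all_algebra finmap.
From mathcomp Require Import all_classical all_reals all_analysis.
From mathcomp Require Import measurable_realfun.

Set Implicit Arguments.
Unset Strict Implicit.
Unset Printing Implicit Defensive.

Import Order.TTheory GRing.Theory Num.Theory.
Import numFieldNormedType.Exports.

Local Open Scope classical_set_scope.
Local Open Scope ring_scope.

(* A point configuration is a set of reals; [npoints A B] is the number of
   points of A in B, equal to +oo when there are infinitely many. *)
Definition npoints (R : realType) (A B : set R) : \bar R := counting (A `&` B).

Definition locally_finite (R : realType) (A : set R) : Prop :=
  forall a b : R, finite_set (A `&` `[a, b]).

Definition mutually_independent d (T : measurableType d) (R : realType)
    (P : probability T R) (I : choiceType) (D : set I)
    (F : I -> set (set T)) : Prop :=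
  forall (J : {fset I}) (E : I -> set T),
    [set` J] `<=` D -> (forall i, i \in J -> F i (E i)) ->
    P (\bigcap_(i in [set` J]) E i) = (\prod_(i <- J) P (E i))%E.

(* N has the Poisson distribution of mean m, with the usual convention that it
   is a.s. infinite when m = +oo. The library's [poisson_pmf] is not used here
   because it equals 1 for every k when the rate is 0; the formula below gives
   the point mass at 0 in that case. *)
Definition poisson_distributed d (T : measurableType d) (R : realType)
    (P : probability T R) (N : T -> \bar R) (m : \bar R) : Prop :=
  match m with
  | r%:E => forall k : nat,
      P [set w | N w = k%:R%:E] = (r ^+ k / k`!%:R * expR (- r))%:E
  | +oo%E => P [set w | N w = +oo%E] = 1%E
  | -oo%E => False
  end.

Record poisson_point_process d (T : measurableType d) (R : realType)
    (P : probability T R) (intensity : set R -> \bar R) (xi : T -> set R) :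
    Prop := PoissonPointProcess {
  ppp_locally_finite : forall w, locally_finite (xi w) ;
  ppp_measurable : forall B : set R, measurable B ->
    measurable_fun setT (fun w => npoints (xi w) B) ;
  ppp_poisson : forall B : set R, measurable B ->
    poisson_distributed P (fun w => npoints (xi w) B) (intensity B) ;
  ppp_independent : forall B : nat -> set R,
    (forall i, measurable (B i)) -> trivIset setT B ->
    mutually_independent P setT (fun i =>
      preimage_set_system setT (fun w => npoints (xi w) (B i)) measurable)
}.

Definition sigma_point_process d (T : measurableType d) (R : realType)
    (xi : T -> set R) : set (set T) :=
  <<s \bigcup_(B in (measurable : set (set R)))
        preimage_set_system setT (fun w => npoints (xi w) B) measurable >>.

Definition zeta_intensity (R : realType) (u : R) (B : set R) : \bar R :=
  (\int[lebesgue_measure]_(x in B) (u * expR (Num.min 0 x))%:E)%E.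

(* The driving family: [xi0] together with [xi k n] for k, n >= 1. It is indexed
   by [option (nat * nat)], with [None] standing for [xi0]; the values of [xi]
   at k = 0 or n = 0 are never used. *)
Definition driving_family (T : Type) (R : realType)
    (xi0 : T -> set R) (xi : nat -> nat -> T -> set R)
    (i : option (nat * nat)) : T -> set R :=
  if i is Some (k, n) then xi k n else xi0.

Definition driving_index : set (option (nat * nat)) :=
  [set i | if i is Some (k, n) then (0 < k)%N /\ (0 < n)%N else True].

Definition iid_poisson_family d (T : measurableType d) (R : realType)
    (P : probability T R) (u : R)
    (xi0 : T -> set R) (xi : nat -> nat -> T -> set R) : Prop :=
  (forall i, driving_index i ->
     poisson_point_process P (zeta_intensity u) (driving_family xi0 xi i)) /\
  mutually_independent P driving_index
    (fun i => sigma_point_process (driving_family xi0 xi i)).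

(* z is the k-th point of A, the points being enumerated in increasing order
   from k = 1. *)
Definition is_kth_point (R : realType) (A : set R) (k : nat) (z : R) : Prop :=
  A z /\ npoints A `]-oo, z] = k%:R%:E.

Definition offspring (R : realType) (A : set R) (z : R) : set R :=
  [set y | exists2 x, A x & y = x + z /\ 0 <= y].

(* The particle process for one realization of the driving family. *)
Fixpoint zeta (R : realType) (A0 : set R) (A : nat -> nat -> set R) (n : nat) :
    set R :=
  match n with
  | 0 => [set 0]
  | m.+1 =>
    match m with
    | 0 => [set x | A0 x /\ 0 <= x]
    | _.+1 => [set y | exists k z,
        [/\ (0 < k)%N, is_kth_point (zeta A0 A m) k z & offspring (A k m) z y]]
    end
  end.

Definition X (T : Type) (R : realType)
    (xi0 : T -> set R) (xi : nat -> nat -> T -> set R)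
    (n : nat) (a b : R) (w : T) : \bar R :=
  npoints (zeta (xi0 w) (fun k m => xi k m w) n) `[a, b].

(* Main.v *)
(* Write [Lambda alpha = u / (alpha * (1 - alpha))] for [0 < alpha < 1]. The points
   [x] of a driving process satisfy [E (sum_x exp (- alpha * x)) = Lambda alpha], so
   dropping the barrier at 0 gives [E (sum_(z in zeta^n) exp (- alpha * z)) <=
   (Lambda alpha)^n]. For [u < 1/4] the choice [alpha = 2 * u] makes [Lambda alpha < 1],
   with [1 - Lambda alpha] of order [1 - 4 * u]; this sums to the first claim. For every
   [u] the bound shows that the generations are almost surely locally finite, so that
   all their points get a rank.

   For the second claim, conjugating the mean kernel [u * exp (- (x - y)^+)] by
   [exp (x / 2)] yields the symmetric kernel [u * exp (- |x - y| / 2)], of total mass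
   [4 * u]. When [4 * u > 1], a sufficiently wide tent function [h] is mapped by it
   above [(1 + eps) * h], hence [E (sum_(z in zeta^n) exp (- z / 2) * h z)] grows
   geometrically, and one more generation brings the particles back to [0, R].
   A generation is a set: one also needs that almost surely no two particles coincide,
   which holds since a Poisson point process almost surely avoids a position that is
   independent of it.

   Both moment computations are carried out on lattices of small cells, so that only
   expected numbers of points in intervals are needed. *)
Require Import Defs.
From HB Require Import structures.
From mathcomp Require Import all_boot all_order all_algebra finmap.
From mathcomp Require Import all_classical all_reals all_analysis.
From mathcomp Require Import measurable_realfun.
From mathcomp Require Import ring lra zify.

Set Implicit Arguments.
Unset Strict Implicit.
Unset Printing Implicit Defensive.

Import Order.TTheory GRing.Theory Num.Theory.
Import numFieldNormedType.Exports.

Local Open Scope classical_set_scope.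
Local Open Scope ring_scope.

(** The tilt [2 * u], rather than the minimizer [1 / 2] of [Lambda], is dictated by the interval:
    counting on [0, R] costs a factor exp (alpha * R), and exp (R / 2) is not controlled by exp (4 *
    u * R) uniformly in small [u]. The driver of a particle is selected by the particle's rank in
    its generation. Rank and position must therefore be functions of the earlier drivers alone,
    which is expressed through the sigma-algebra that these generate. No conditional expectation is
    formed: every moment reduces to the mean of a product of a factor measurable for the past and a
    count of a fresh driver on a deterministic interval. This is why cells are used, since the
    position of a parent is random but its cell can be summed over. Ranks require local finiteness,
    which holds only almost surely. The argument thus runs on a modified process that is emptied
    when local finiteness fails, and is transferred to [zeta] off a null set. *)

(** * Integrals and independence *)

(* Neither function needs to be measurable, since the integral of a nonnegative
   function is the supremum of the integrals of the simple functions below it. The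
   number of particles [X] is only known to be measurable up to a null set. *)
Lemma ge0_le_integralT d (T : measurableType d) (R : realType)
    (mu : {measure set T -> \bar R}) (f g : T -> \bar R) :
  (forall x, 0 <= f x)%E -> (forall x, f x <= g x)%E ->
  (\int[mu]_x f x <= \int[mu]_x g x)%E.
Proof.
move=> f0 fg; rewrite !ge0_integralTE//; last first.
  by move=> x; exact: le_trans (f0 x) (fg x).
apply: ub_ereal_sup => _ [h hf <-]; apply: ereal_sup_ubound; exists h => //= x.
exact: le_trans (hf x) (fg x).
Qed.

Lemma g_sigma_measurable d (T : measurableType d) (G : set (set T)) :
  G `<=` measurable -> <<s G >> `<=` measurable.
Proof. by move=> ?; apply: smallest_sub => //; exact: sigma_algebra_measurable. Qed.

Section independence.
Context d (T : measurableType d) (R : realType) (P : probability T R).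
Context (I : choiceType) (D0 : set I) (F : I -> set (set T)).
Hypothesis indF : mutually_independent P D0 F.
Hypothesis sF : forall i, D0 i -> sigma_algebra setT (F i).
Hypothesis mF : forall i, D0 i -> F i `<=` measurable.

(** The finite measures sending [B] to [P (B & A)] (intersection with [A]) and to [P B * P A] agree
    on finite intersections of events of the [F j]. These form a pi-system generating the
    sigma-algebra, so the measures agree on all of it. *)
Lemma independent_sigma_bigcup (D : set I) (i : I) (E A : set T) :
  D `<=` D0 -> D0 i -> ~ D i ->
  <<s \bigcup_(j in D) F j >> E -> F i A -> P (E `&` A) = (P E * P A)%E.
Proof.
move=> DD0 D0i nDi sE FA.
have mA : measurable A by exact: mF FA.
have FT j : D0 j -> F j setT.
  by move=> /sF [F0 FC _]; rewrite -(setD0 setT); exact: FC.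
have FI j : D0 j -> setI_closed (F j).
  move=> /sF sFj B C FB FC.
  have E' : <<s (F j) >> = F j by exact: sigma_algebra_id.
  by move: FB FC; rewrite -E' => FB FC;
    exact: (@measurableI _ (g_sigma_algebraType (F j))).
pose G := [set B | exists (J : {fset I}) (C : I -> set T),
  [/\ [set` J] `<=` D, forall j, D j -> F j (C j) &
      B = \bigcap_(j in [set` J]) C j]].
have GI : setI_closed G.
  (* Two finite families are merged over the union of their index sets, the missing events being
     padded with [setT]. *)
  move=> _ _ [J [C [JD FC ->]]] [K [C' [KD FC' ->]]].
  exists (J `|` K)%fset, (fun j => (if j \in J then C j else setT) `&`
                                 (if j \in K then C' j else setT)); split.
  - by move=> j /=; rewrite inE => /orP[/JD|/KD].
  - move=> j Dj; apply: FI; first exact: DD0.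
      by case: ifP => _; [exact: FC|apply/FT/DD0].
    by case: ifP => _; [exact: FC'|apply/FT/DD0].
  - apply/seteqP; split => [x [HC HC'] j /= _|x HCC].
      by split; case: ifPn => // ?; [exact: HC|exact: HC'].
    split=> j /= jJ; have /= := HCC j; rewrite inE jJ ?orbT => /(_ isT) [];
      by rewrite ?jJ.
have Gm : G `<=` measurable.
  move=> _ [J [C [JD FC ->]]]; apply: fin_bigcap_measurable => // j /JD Dj.
  by apply: (mF (DD0 _ Dj)); exact: FC.
have GT : G setT.
  exists fset0, (fun=> setT); split => //; first by move=> j /DD0/FT.
  by rewrite set_fset0 bigcap_set0.
have sub : <<s \bigcup_(j in D) F j >> `<=` <<s G >>.
  apply: sub_sigma_algebra2 => B [j Dj FjB].
  exists [fset j]%fset, (fun k => if k == j then B else setT); split.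
  - by move=> k /=; rewrite inE => /eqP ->.
  - by move=> k Dk; case: eqP => [->//|_]; apply/FT/DD0.
  - by rewrite set_fset1 bigcap_set1 eqxx.
pose r := NngNum (fine_ge0 (measure_ge0 P A)).
have rE : (r%:num)%:E = P A by rewrite /= fineK// fin_num_measure.
have msE B : mscale r P B = (P B * P A)%E by rewrite muleC -rE.
suff : mrestr P mA E = mscale r P E by move=> h; rewrite -[LHS]/(mrestr P mA E) h;
  exact: msE.
apply: (@g_sigma_algebra_measure_unique _ R T G Gm (fun=> setT) (fun=> GT) _
  (mrestr P mA) (mscale r P) GI _ _ E (sub _ sE)).
- by apply/seteqP; split => // x _; exists 0%N.
- move=> _ [J [C [JD FC ->]]].
  apply: (eq_trans _ (esym (msE _))).
  change (P ((\bigcap_(j in [set` J]) C j) `&` A) =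
    (P (\bigcap_(j in [set` J]) C j) * P A)%E).
  have iJ : i \notin J by apply/negP => /JD.
  pose C' k := if k == i then A else C k.
  have C'J j : j \in J -> C' j = C j.
    by rewrite /C'; case: eqP => // -> iJ'; rewrite iJ' in iJ.
  have -> : (\bigcap_(j in [set` J]) C j) `&` A =
            \bigcap_(j in [set` (i |` J)%fset]) C' j.
    rewrite bigcap_fsetU1 setIC /C' eqxx; congr (_ `&` _).
    by apply: eq_bigcapr => j /= /C'J; rewrite /C' => ->.
  rewrite (indF (E := C')); last 2 first.
  - by move=> j /=; rewrite !inE => /orP[/eqP -> //|/JD/DD0].
  - move=> j; rewrite !inE => /orP[/eqP -> |jJ]; first by rewrite /C' eqxx.
    by rewrite C'J//; apply/FC/JD.
  rewrite big_fsetU1//= {1}/C' eqxx; rewrite muleC; congr (_ * _)%E.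
  rewrite indF; first by apply: eq_big_seq => j /C'J ->.
    by move=> j /JD/DD0.
  by move=> j /JD/FC.
- by move=> _; rewrite (le_lt_trans (probability_le1 _ _)) ?ltry//;
  exact: measurableI.
Qed.
End independence.

(** * Counting points *)

Section counting_facts.
Context (R : realType).
Implicit Types A B : set R.
Local Notation cnt := (@counting R R).

Lemma counting_ge0 A : (0 <= cnt A)%E.
Proof. by rewrite /counting; case: ifP => _; rewrite ?lee_fin ?leey. Qed.

Lemma countingE A : cnt A = \esum_(x in A) 1%E.
Proof.
rewrite /counting; case: ifPn => /asboolP fA; first by rewrite finite_card_sum.
apply/esym/eqyP => r r0.
have [B BA Br] := infinite_set_fset (Num.truncn r).+1 fA.
apply: esum_ge; exists [set` B] => //.
apply: (@le_trans _ _ (Num.truncn r).+1%:R%:E).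
  by rewrite lee_fin ltW// truncnS_gt.
move: Br; rewrite -(@ler_nat R) -lee_fin => /le_trans; apply.
by rewrite fsbig_finite//= card_fset_sum1 sumEFin natr_sum// set_fsetK.
Qed.

Lemma le_counting A B : A `<=` B -> (cnt A <= cnt B)%E.
Proof.
move=> AB; rewrite !countingE (esum_mkcond A) (esum_mkcond B).
apply: le_esum => x _; case: ifPn => [/set_mem/AB/mem_set ->//|_].
by case: ifP => _; rewrite lee_fin.
Qed.

Lemma counting_fin A : finite_set A -> cnt A = #|`fset_set A|%:R%:E.
Proof. by move=> fA; rewrite /counting asboolT. Qed.

Lemma counting_lty A : (cnt A < +oo)%E -> finite_set A.
Proof. by rewrite /counting; case: ifPn => [/asboolP|]//; rewrite ltxx. Qed.

Lemma counting_natP A : cnt A = +oo%E \/ exists n : nat, cnt A = n%:R%:E.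
Proof. by rewrite /counting; case: ifP => _; [right; eexists|left]. Qed.

Lemma counting0 : cnt set0 = 0%E.
Proof. by rewrite countingE esum_set0. Qed.

Lemma counting_ge1 A x : A x -> (1 <= cnt A)%E.
Proof.
move=> Ax; rewrite -[X in (X <= _)%E](_ : cnt [set x] = 1%E); last first.
  by rewrite countingE esum_set1.
by apply: le_counting => _ ->.
Qed.

Lemma counting_gt0 A : (0 < cnt A)%E -> A !=set0.
Proof.
by move=> A0; apply/set0P/eqP => A00; rewrite A00 counting0 ltxx in A0.
Qed.

(** Layer-cake formula: a count becomes a series of indicators of events, so that independence and
    measurability need only be known for events. *)
Lemma counting_layer A :
  cnt A = (\sum_(m <oo) (if m.+1%:R%:E <= cnt A then 1 else 0))%E.
Proof.
have pos (x : \bar R) (m : nat) : (0 <= if m.+1%:R%:E <= x then 1 else 0 :> \bar R)%E.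
  by case: ifP.
have [->|[n ->]] := counting_natP A.
  apply/esym/eqyP => r r0.
  apply: (le_trans _ (nneseries_lim_ge (Num.truncn r).+1 _)) => //.
  under eq_bigr do rewrite leey.
  rewrite sumEFin sumr_const_nat subn0 lee_fin.
  by rewrite ltW// truncnS_gt.
rewrite (nneseries_split 0 n)// add0n [X in (_ + X)%E]eseries0 ?adde0.
  rewrite big_mkord (eq_bigr (fun=> 1%:E)).
    by rewrite sumEFin sumr_const card_ord.
  by move=> i _; rewrite lee_fin ler_nat ltn_ord.
by move=> i ni _; rewrite lee_fin ler_nat ltnNge ni.
Qed.

End counting_facts.

(** * Integration over events and over sub-sigma-algebras *)

Section integral_facts.
Context d (T : measurableType d) (R : realType).

Lemma ge0_le_integralD (mu : {measure set T -> \bar R}) (D : set T) (f g : T ->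
  \bar R) :
  (forall x, D x -> 0 <= f x)%E -> (forall x, D x -> f x <= g x)%E ->
  (\int[mu]_(x in D) f x <= \int[mu]_(x in D) g x)%E.
Proof.
move=> f0 fg; rewrite integral_mkcond [leRHS]integral_mkcond.
apply: ge0_le_integralT => x; rewrite /patch; case: ifPn => // /set_mem Dx.
  exact: f0.
exact: fg.
Qed.

Lemma integral_mrestr (mu : {measure set T -> \bar R}) (A : set T)
    (mA : measurable A) (f : T -> \bar R) :
  measurable_fun setT f -> (forall x, 0 <= f x)%E ->
  (\int[mrestr mu mA]_x f x = \int[mu]_(x in A) f x)%E.
Proof.
move=> mf f0; rewrite -(setUv A) ge0_integral_setU//=; last 3 first.
- exact: measurableC.
- by rewrite setUv.
- by apply/disj_setPS => x [].
rewrite [X in (_ + X)%E](_ : _ = 0%E) ?adde0.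
  apply: eq_measure_integral => B mB BA.
  by change (mu (B `&` A) = mu B); rewrite setIidl.
apply/eqP; rewrite eq_le integral_ge0// andbT.
rewrite (@null_set_integral _ _ _ (mrestr mu mA))//.
- exact: measurableC.
- exact: measurable_funTS.
- by change (mu (~` A `&` A) = 0%E); rewrite setICl measure0.
Qed.

End integral_facts.

Lemma g_sigma_measurable_funT d (T : measurableType d) (G : set (set T)) d'
    (T' : measurableType d') (f : T -> T') :
  G `<=` measurable ->
  measurable_fun (setT : set (g_sigma_algebraType G)) f -> measurable_fun setT f.
Proof.
by move=> Gm mf _ B mB; apply: (g_sigma_measurable Gm); exact: mf.
Qed.

(** On the sigma-algebra generated by [G], the restriction of [P] to [A] equals [P A] times [P]. The
    identity map onto the space with that smaller sigma-algebra is measurable, so both integrals can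
    be pushed forward there and compared. *)
Lemma integral_independent d (T : measurableType d) (R : realType)
    (P : probability T R) (G : set (set T)) (A : set T) (f : T -> \bar R) :
  G `<=` measurable -> measurable A ->
  (forall E, <<s G >> E -> P (E `&` A) = P E * P A)%E ->
  measurable_fun (setT : set (g_sigma_algebraType G)) f ->
  (forall x, 0 <= f x)%E ->
  (\int[P]_(x in A) f x = \int[P]_x f x * P A)%E.
Proof.
move=> Gm mA ind mf f0.
have mid : measurable_fun setT (id : T -> g_sigma_algebraType G).
  by move=> _ B mB; rewrite setTI; exact: (g_sigma_measurable Gm).
have mfT : measurable_fun setT (f : T -> \bar R) by exact: g_sigma_measurable_funT mf.
pose r := NngNum (fine_ge0 (measure_ge0 P A)).
have rE : (r%:num)%:E = P A by rewrite /= fineK// fin_num_measure.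
rewrite -(integral_mrestr P mA)//.
have h1 := @ge0_integral_pushforward _ _ _ _ _ _ mid (mrestr P mA) setT f
  measurableT mf (fun y _ => f0 y).
have h2 := @ge0_integral_pushforward _ _ _ _ _ _ mid P setT f
  measurableT mf (fun y _ => f0 y).
rewrite preimage_setT in h1 h2.
rewrite -h1 -h2 -rE muleC -ge0_integral_mscale//.
apply: eq_measure_integral => B mB _.
by change (P (B `&` A) = (r%:num)%:E * P B)%E; rewrite ind// muleC -rE.
Qed.

(** The scalar may be [+oo], as it will be a count or a mean not yet known to be finite. In that
    case both sides are infinite if some term is positive, and zero otherwise. *)
Lemma nneseriesZle (R : realType) (x : \bar R) (f : nat -> \bar R) :
  (0 <= x)%E -> (forall i, 0 <= f i)%E ->
  (x * \sum_(i <oo) f i = \sum_(i <oo) (x * f i))%E.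
Proof.
case: x => [x||//] x0 f0; first by rewrite nneseriesZl.
have [[k fk]|fz] := pselect (exists k, (0 < f k)%E).
  rewrite [RHS](@nneseries_pinfty _ (fun i => +oo * f i)%E xpredT k)//; last 2 first.
  - by move=> n _; rewrite mule_ge0.
  - by rewrite gt0_mulye.
  rewrite gt0_mulye// (lt_le_trans fk)//.
  apply: (le_trans _ (nneseries_lim_ge k.+1 _)) => //.
  by rewrite big_nat_recr//= leeDr// sume_ge0.
have f00 i : f i = 0%E.
  by apply/eqP; rewrite eq_le f0 andbT leNgt; apply/negP => ?; apply: fz; exists i.
by rewrite !eseries0 ?mule0// => i _ _; rewrite f00 ?mule0.
Qed.

(** * Poisson point processes *)

Section poisson_mean.
Context d (T : measurableType d) (R : realType) (P : probability T R).
Local Open Scope ereal_scope.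

Let poisson_weights (r : R) : (0 <= r)%R ->
  \sum_(k <oo) (r ^+ k / k`!%:R * expR (- r))%:E = 1.
Proof.
move=> r0; transitivity (\sum_(k <oo) ((expR (- r))%:E * (exp_coeff r k)%:E)).
  by apply: eq_eseriesr => k _; rewrite -EFinM mulrC.
rewrite nneseriesZl; last by move=> k _; rewrite lee_fin exp_coeff_ge0.
rewrite (_ : \sum_(k <oo) (exp_coeff r k)%:E = (expR r)%:E).
  by rewrite -EFinM -expRD addNr expR0.
rewrite /expR -EFin_lim; last exact: is_cvg_series_exp_coeff.
by apply/congr_lim/funext => n /=; rewrite sumEFin.
Qed.

Let poisson_moment (r : R) : (0 <= r)%R ->
  \sum_(k <oo) k%:R%:E * (r ^+ k / k`!%:R * expR (- r))%:E = r%:E.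
Proof.
move=> r0; have w0 k : 0 <= (r ^+ k / k`!%:R * expR (- r))%:E.
  by rewrite lee_fin mulr_ge0 ?expR_ge0// divr_ge0// exprn_ge0.
have kw0 k : 0 <= k%:R%:E * (r ^+ k / k`!%:R * expR (- r))%:E.
  by apply: mule_ge0; rewrite ?w0// lee_fin.
(* The term [k = 0] vanishes; shifting the index leaves [r] times the total mass. *)
rewrite nneseries_recl//.
rewrite mul0e add0e -[RHS]mule1 -(poisson_weights r0) -nneseriesZl//.
rewrite -[in LHS](addn0 1%N) -nneseries_addn//.
apply: eq_eseriesr => k _; rewrite addn0 addn1 -!EFinM; congr EFin.
rewrite factS natrM exprS; field.
by rewrite nat1r !pnatr_eq0 -lt0n fact_gt0.
Qed.

(** Only the probabilities of finite values are prescribed. They sum to 1, so [N] is almost surely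
    finite and its integral splits over its level sets. *)
Lemma poisson_mean (N : T -> \bar R) (r : R) : measurable_fun setT N ->
  (forall w, N w = +oo \/ exists n : nat, N w = n%:R%:E) -> (0 <= r)%R ->
  poisson_distributed P N r%:E -> \int[P]_w N w = r%:E.
Proof.
move=> mN Nnat r0 /= Pois.
pose F (k : nat) := [set w | N w = k%:R%:E].
have mF k : measurable (F k).
  by rewrite -[F k]setTI; exact: (mN measurableT [set k%:R%:E]).
have tF : trivIset setT F.
  apply/trivIsetP => i j _ _ ij; rewrite -subset0 => w [Fi Fj].
  have /eqP := etrans (esym Fi) Fj; by rewrite eqe eqr_nat (negPf ij).
pose U := \bigcup_k F k.
have mU : measurable U by exact: bigcupT_measurable.
have PU : P U = 1.
  rewrite measure_bigcup//= -(poisson_weights r0).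
  rewrite (eq_eseriesl (Q := xpredT)); last by move=> k; rewrite in_setT.
  by apply: eq_eseriesr => k _; exact: Pois.
have PCU : P (~` U) = 0 by rewrite probability_setC// PU subee.
have N0 w : 0 <= N w.
  by have [->|[n ->]] := Nnat w; rewrite ?leey// lee_fin.
rewrite (@ge0_negligible_integral _ _ _ _ _ (~` U))//; last exact: measurableC.
rewrite setTD setCK ge0_integral_bigcup//; last exact: measurable_funTS.
rewrite -(poisson_moment r0); apply: eq_eseriesr => k _.
rewrite (eq_integral (cst k%:R%:E)); last by move=> w /set_mem.
by rewrite integral_cst//; congr (_ * _); exact: Pois.
Qed.
End poisson_mean.

Section zeta_intensity_bounds.
Context (R : realType) (u : R).
Hypothesis u0 : 0 < u.

Lemma zeta_intensity_le (a b c : R) : a <= b ->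
  (forall x, a <= x < b -> expR (Num.min 0 x) <= c) ->
  (zeta_intensity u `[a, b[ <= (u * c * (b - a))%:E)%E.
Proof.
move=> ab H; rewrite /zeta_intensity.
apply: (@le_trans _ _ (\int[lebesgue_measure]_(x in `[a, b[) (u * c)%:E)%E).
  apply: ge0_le_integralD => x /=; rewrite in_itv /= => /H Hx.
    by rewrite lee_fin mulr_ge0 ?expR_ge0// ltW.
  by rewrite lee_fin ler_pM2l.
rewrite integral_cst//= lebesgue_measure_itv/= lte_fin.
by case: ltP => ab'; rewrite ?mule0 ?lee_fin -?EFinB -?EFinM// (le_anti (introT
  andP (conj ab ab'))) subrr mulr0.
Qed.

Lemma zeta_intensity_ge (a b c : R) : a <= b -> 0 <= c ->
  (forall x, a <= x < b -> c <= expR (Num.min 0 x)) ->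
  ((u * c * (b - a))%:E <= zeta_intensity u `[a, b[)%E.
Proof.
move=> ab c0 H; rewrite /zeta_intensity.
apply: (@le_trans _ _ (\int[lebesgue_measure]_(x in `[a, b[) (u * c)%:E)%E);
  last first.
  apply: ge0_le_integralD => x /=; rewrite in_itv /= => /H Hx.
    by rewrite lee_fin mulr_ge0 // ltW.
  by rewrite lee_fin ler_pM2l.
rewrite integral_cst//= lebesgue_measure_itv/= lte_fin.
by case: ltP => ab'; rewrite ?mule0 ?lee_fin -?EFinB -?EFinM// (le_anti (introT
  andP (conj ab ab'))) subrr mulr0.
Qed.

Lemma zeta_intensity_ge0 (B : set R) : (0 <= zeta_intensity u B)%E.
Proof.
by apply: integral_ge0 => x _; rewrite lee_fin mulr_ge0 ?expR_ge0// ltW.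
Qed.

Lemma zeta_intensity_le1 (a b : R) : a <= b ->
  (zeta_intensity u `[a, b[ <= (u * (b - a))%:E)%E.
Proof.
move=> ab; rewrite -[u in leRHS]mulr1; apply: zeta_intensity_le => // x _.
by rewrite -[leRHS]expR0 ler_expR ge_min lexx.
Qed.

Lemma zeta_intensity_fin (a b : R) : a <= b ->
  exists2 r : R, 0 <= r & zeta_intensity u `[a, b[ = r%:E.
Proof.
move=> ab; have := zeta_intensity_le1 ab; have := zeta_intensity_ge0 `[a, b[.
case: (zeta_intensity _ _) => [r|//|//] r0 _; exists r => //.
Qed.
End zeta_intensity_bounds.

Section ppp_facts.
Context d (T : measurableType d) (R : realType) (P : probability T R) (u : R).
Hypothesis u0 : 0 < u.
Variable xi : T -> set R.
Hypothesis ppp : poisson_point_process P (zeta_intensity u) xi.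

Lemma ppp_mean (a b : R) : a <= b ->
  (\int[P]_w npoints (xi w) `[a, b[ = zeta_intensity u `[a, b[)%E.
Proof.
move=> ab; have [r r0 rE] := zeta_intensity_fin u0 ab.
have mB : measurable (`[a, b[ : set R) by [].
rewrite rE; apply: poisson_mean => //.
- exact: (ppp_measurable ppp).
- by move=> w; exact: counting_natP.
- by rewrite -rE; exact: (ppp_poisson ppp).
Qed.

Lemma sigma_point_process_measurable :
  sigma_point_process xi `<=` measurable.
Proof.
apply: g_sigma_measurable => _ [B mB [C mC <-]].
exact: (ppp_measurable ppp).
Qed.

(** The events that the count is at least [m.+1] belong to the sigma-algebra of [xi]; the product
    rule is applied to each of them and summed by the layer-cake formula. *)
Lemma integral_npoints_independent (G : set (set T)) (f : T -> \bar R) (a b : R) :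
  a <= b -> G `<=` measurable ->
  (forall E A, <<s G >> E -> sigma_point_process xi A ->
    P (E `&` A) = P E * P A)%E ->
  measurable_fun (setT : set (g_sigma_algebraType G)) f ->
  (forall x, 0 <= f x)%E ->
  (\int[P]_w (f w * npoints (xi w) `[a, b[) =
    \int[P]_w f w * zeta_intensity u `[a, b[)%E.
Proof.
move=> ab mG ind mf f0; rewrite -(ppp_mean ab).
have mB : measurable (`[a, b[ : set R) by [].
set N := fun w => npoints (xi w) _.
have mN : measurable_fun setT N by exact: (ppp_measurable ppp).
pose A m := [set w | (m.+1%:R%:E <= N w)%E].
have mA m : measurable (A m).
  by rewrite -[A m]setTI; exact: emeasurable_fun_c_infty.
have sA m : sigma_point_process xi (A m).
  apply: sub_sigma_algebra; exists (`[a, b[%classic) => //.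
  exists (`[m.+1%:R%:E, +oo[%classic).
    exact: emeasurable_itv.
  by rewrite setTI; apply/seteqP; split => w /=; rewrite /A /= in_itv /= andbT.
have mfT : measurable_fun setT (f : T -> \bar R).
  exact: g_sigma_measurable_funT mf.
have NE w : N w = (\sum_(m <oo) (\1_(A m) w)%:E)%E.
  rewrite {1}/N /npoints counting_layer; apply: eq_eseriesr => m _.
  by rewrite indicE /A; case: ifPn => h;
    [rewrite mem_set|rewrite memNset// => /= h'; rewrite h' in h].
transitivity (\int[P]_w \sum_(m <oo) (f w * (\1_(A m) w)%:E))%E.
  apply: eq_integral => w _; rewrite -/(N w) NE.
  by rewrite nneseriesZle// => m; rewrite lee_fin.
rewrite integral_nneseries//; last 2 first.
- move=> m; apply: emeasurable_funM => //.
  by apply/measurable_EFinP; exact: measurable_indic.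
- by move=> m w _; rewrite mule_ge0// lee_fin.
transitivity (\sum_(m <oo) (\int[P]_w f w * P (A m)))%E.
  apply: eq_eseriesr => m _.
  rewrite -(integral_independent mG (mA m) _ mf f0); last first.
    by move=> E sE; exact: ind.
  rewrite [RHS]integral_mkcond; apply: eq_integral => w _.
  by rewrite epatch_indic.
transitivity (\int[P]_w f w * \sum_(m <oo) P (A m))%E.
  by rewrite nneseriesZle//; exact: integral_ge0.
congr (_ * _)%E; transitivity (\int[P]_w (\sum_(m <oo) (\1_(A m) w)%:E))%E.
  rewrite integral_nneseries//; last first.
    by move=> m; apply/measurable_EFinP; exact: measurable_indic.
  by apply: eq_eseriesr => m _; rewrite integral_indic// setIT.
by apply: eq_integral => w _; rewrite -NE.
Qed.
End ppp_facts.

(** * Ranked points and random locally finite sets *)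

Section kth_points.
Context (R : realType).
Implicit Types A B C : set R.
Local Notation cnt := (@counting R R).

(** Turns a lower bound on a possibly infinite count into the choice of finitely many distinct
    points, which can later be selected by countably many labels. *)
Lemma counting_geP C n :
  (n%:R%:E <= cnt C)%E <-> exists2 y : 'I_n -> R, injective y & forall i, C (y i).
Proof.
split => [nC|[y yinj Cy]].
  have [F FC Fn] : exists2 F : {fset R}, [set` F] `<=` C & (n <= #|` F|)%N.
    have [fC|iC] := pselect (finite_set C); last first.
      by have [F FC Fn] := infinite_set_fset n iC; exists F.
    exists (fset_set C); first by move=> x /=; rewrite in_fset_set// => /set_mem.
    by move: nC; rewrite counting_fin// lee_fin ler_nat.
  exists (fun i : 'I_n => nth 0 F i) => [i j|i].
    move/eqP; rewrite nth_uniq ?fset_uniq//; try exact: leq_trans (ltn_ord _) Fn.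
    by move/eqP/val_inj.
  by apply/FC/mem_nth; exact: leq_trans (ltn_ord _) Fn.
apply: (@le_trans _ _ (cnt [set` [fset y i | i in 'I_n]%fset])).
  rewrite counting_fin// lee_fin ler_nat set_fsetK card_imfset//=.
  by rewrite size_enum_ord.
by apply: le_counting => x /= /imfsetP[i _ ->].
Qed.

Lemma counting_lt C C' z : C `<=` C' -> finite_set C' -> C' z -> ~ C z ->
  (cnt C < cnt C')%E.
Proof.
move=> CC' fC' C'z nCz; have fC : finite_set C by exact: sub_finite_set fC'.
rewrite !counting_fin// lte_fin ltr_nat; apply: fproper_ltn_card.
rewrite fproperE; apply/andP; split.
  by apply/fsubsetP => x; rewrite !in_fset_set// !inE; exact: CC'.
apply/negP => /fsubsetP /(_ z); rewrite !in_fset_set// !inE => /(_ C'z); exact: nCz.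
Qed.

Lemma finite_set_max C : finite_set C -> C !=set0 ->
  exists2 z, C z & forall y, C y -> y <= z.
Proof.
move=> fC [x Cx].
have xF : x \in fset_set C by rewrite in_fset_set// inE.
pose m := [arg max_(i > [` xF]%fset) (val i)]%O.
exists (val m).
  by have := valP m; rewrite in_fset_set// => /set_mem.
move=> y Cy; have yF : y \in fset_set C by rewrite in_fset_set// inE.
rewrite /m; case: Order.TotalTheory.arg_maxP => //= i _ /(_ [` yF]%fset isT).
by [].
Qed.

Lemma is_kth_point_inj A k z z' : locally_finite A -> A `<=` [set x | 0 <= x] ->
  is_kth_point A k z -> is_kth_point A k z' -> z = z'.
Proof.
move=> lfA A0; wlog: z z' / z < z'.
  move=> H kz kz'; have [zz'|z'z|//] := ltgtP z z'; first exact: H.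
  by apply/esym; exact: H.
move=> zz' [Az cz] [Az' cz'].
have fz' : finite_set (A `&` `]-oo, z']).
  apply: sub_finite_set (lfA 0 z') => x [Ax]; rewrite /= !in_itv /= => xz'.
  by split => //; rewrite xz' andbT; exact: A0.
suff : (cnt (A `&` `]-oo, z]) < cnt (A `&` `]-oo, z']))%E.
  by rewrite /npoints in cz cz'; rewrite cz cz' ltxx.
apply: (@counting_lt _ _ z') => //.
- move=> x [Ax]; rewrite /= !in_itv /= => xz; split => //.
  by rewrite (le_trans xz)// ltW.
- by split => //=; rewrite in_itv /=.
- by move=> [_]; rewrite /= in_itv /= leNgt zz'.
Qed.

(** Induction on the number of points in the ray: either the largest point has rank [k], or it is
    removed. The removal leaves an open ray, hence the general side [b] of the endpoint. *)
Lemma ex_kth_point A k (b : bool) t : (0 < k)%N ->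
  finite_set (A `&` [set` Interval -oo%O (BSide b t)]) ->
  (k%:R%:E <= npoints A [set` Interval -oo%O (BSide b t)])%E ->
  exists z, is_kth_point A k z /\ z \in Interval -oo%O (BSide b t).
Proof.
move=> k0 fC; rewrite /npoints (counting_fin fC) lee_fin ler_nat => kC.
have [n Cn] : exists n, (#|` fset_set (A `&` [set` Interval -oo%O (BSide b t)]) |
  <= n)%N.
  by eexists.
elim: n b t fC kC Cn => [|n IH] b t fC kC Cn.
  by have := leq_trans kC Cn; rewrite leqNgt k0.
set C := A `&` _ in fC kC Cn.
have C0 : C !=set0.
  apply/set0P/eqP => C0; move: kC; rewrite C0 fset_set0 cardfs0.
  by rewrite leqNgt k0.
have [z [Az zt] Cz] := finite_set_max fC C0.
have CE : A `&` `]-oo, z] = C.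
  apply/seteqP; split => x [Ax xz]; split => //.
    move: xz zt; rewrite /= !in_itv /=.
    by case: (b) => /= xz; [exact: le_lt_trans|exact: le_trans].
  by rewrite /= in_itv /=; exact: Cz.
have [kE|nkC] := eqVneq k #|` fset_set C|.
  by exists z; split => //; split => //; rewrite /npoints CE counting_fin// kE.
pose C' := A `&` [set` Interval -oo%O (BSide true z)].
have C'C : C' `<=` C.
  rewrite -CE => x [Ax]; rewrite /= !in_itv /= => xz; split => //.
  exact: ltW.
have fC' : finite_set C' by exact: sub_finite_set fC.
have CC' : C = z |` C'.
  apply/seteqP; split => x.
    rewrite -CE => -[Ax]; rewrite /= in_itv /= le_eqVlt => /orP[/eqP ->|xz].
      by left.
    by right; split => //=; rewrite in_itv.
  by move=> [->|/C'C].
have nC'z : ~ C' z by case=> _; rewrite /= in_itv /= ltxx.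
have CC'card : #|` fset_set C| = (#|` fset_set C'|).+1.
  rewrite CC' fset_setU1// cardfsU1 in_fset_set// memNset//.
have [|| y [ky]] := IH true z fC'.
- rewrite -/C' -ltnS -CC'card ltn_neqAle nkC//.
- by rewrite -/C' -ltnS -CC'card.
rewrite in_itv /= => yz; exists y; split => //.
have : C z by split.
rewrite -CE => -[_]; move: zt yz; rewrite !in_itv /=.
by case: (b) => /= zt yz _; [exact: lt_trans zt|exact/ltW/(lt_le_trans yz)].
Qed.

(** The default 0 is itself a possible position, so every use is restricted to the event
    [has_kth]. *)
Definition kth_point A k : R := xget 0 [set z | is_kth_point A k z].

Lemma kth_pointP A k : (exists z, is_kth_point A k z) ->
  is_kth_point A k (kth_point A k).
Proof. by move=> [z kz]; exact: (@xgetPex _ 0 [set z | is_kth_point A k z]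
  (ex_intro _ z kz)). Qed.

Lemma kth_pointE A k z : locally_finite A -> A `<=` [set x | 0 <= x] ->
  is_kth_point A k z -> z = kth_point A k.
Proof.
move=> lfA A0 kz; apply: (is_kth_point_inj lfA A0 kz).
by apply: kth_pointP; exists z.
Qed.

Lemma is_kth_point_rank A k l z : is_kth_point A k z -> is_kth_point A l z -> k = l.
Proof.
by move=> [_ kz] [_]; rewrite kz => -[/eqP]; rewrite eqr_nat => /eqP.
Qed.

Lemma locally_finite_ray A t : locally_finite A -> A `<=` [set x | 0 <= x] ->
  finite_set (A `&` `]-oo, t]).
Proof.
move=> lfA A0; apply: sub_finite_set (lfA 0 t) => x [Ax].
rewrite /= !in_itv /= => xt; split => //; rewrite xt andbT; exact: A0.
Qed.

Lemma point_is_kth A z : locally_finite A -> A `<=` [set x | 0 <= x] -> A z ->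
  exists2 k, (0 < k)%N & is_kth_point A k z.
Proof.
move=> lfA A0 Az; have fz := locally_finite_ray z lfA A0.
exists #|` fset_set (A `&` `]-oo, z])|; last first.
  by split => //; rewrite /npoints counting_fin.
rewrite -(@ltr_nat R) -lte_fin -counting_fin//.
apply: (lt_le_trans (y := 1%:E)) => //.
by apply: (@counting_ge1 _ _ z); split => //=; rewrite in_itv /=.
Qed.

(** Expresses the order statistic through counts on rays, from which its measurability follows. *)
Lemma kth_point_le A k t : locally_finite A -> A `<=` [set x | 0 <= x] -> (0 < k)%N ->
  (exists z, is_kth_point A k z /\ z <= t) <-> (k%:R%:E <= npoints A `]-oo, t])%E.
Proof.
move=> lfA A0 k0; split => [[z [[Az <-] zt]]|].
  apply: le_counting => x [Ax]; rewrite /= !in_itv /= => xz; split => //.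
  exact: le_trans zt.
move/(ex_kth_point k0 (locally_finite_ray t lfA A0)) => [z [kz zt]].
by exists z; split => //; move: zt; rewrite in_itv.
Qed.
End kth_points.

(** * Measurable enumeration of a random locally finite set *)

Section random_sets.
Context d (T : measurableType d) (R : realType).

Definition random_locally_finite (A : T -> set R) : Prop :=
  (forall w, locally_finite (A w)) /\
  (forall B, measurable B -> measurable_fun setT (fun w => npoints (A w) B)).

Lemma isolated_rat (A : set R) (y : R) : locally_finite A -> A y ->
  exists pq : rat * rat, A `&` `]ratr pq.1, ratr pq.2[ = [set y].
Proof.
move=> lfA Ay.
pose F := (A `&` `[y - 1, y + 1]) `\ y.
have cF : closed F.
  apply: (@accessible_finite_set_closed R).1; last exact: finite_setD.
  exact/hausdorff_accessible/Rhausdorff.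
have : nbhs y (~` F) by apply: open_nbhs_nbhs; split;
  [exact: closed_openC|by move=> [_]; apply].
move=> /nbhs_ballP[e /= e0 yF].
(* The cap 1 keeps the rational interval inside the window used to define [F]. *)
have e1 : 0 < Num.min e 1 by rewrite lt_min e0 ltr01.
have [|p] := @rat_in_itvoo R (y - Num.min e 1) y; first by rewrite gtrBl.
rewrite in_itv /= => /andP[p1 p2].
have [|q] := @rat_in_itvoo R y (y + Num.min e 1); first by rewrite ltrDl.
rewrite in_itv /= => /andP[q1 q2].
exists (p, q); apply/seteqP; split => [x [Ax]|_ ->] /=.
  rewrite in_itv /= => /andP[px xq]; apply: contrapT => xy.
  have := yF x; rewrite /ball /= => H.
  have xe : `|y - x| < Num.min e 1 by rewrite ltr_norml; apply/andP; split; lra.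
  move: xe; rewrite lt_min => /andP[xe x1]; apply: (H xe); split => //.
  split => //=; rewrite in_itv /=; move: x1; rewrite ltr_norml => /andP[]; lra.
by split => //; rewrite in_itv /= p2.
Qed.

Lemma counting_eq1 (C : set R) : @counting R R C = 1%E -> exists y, C = [set y].
Proof.
move=> C1.
have [|y _ Cy] := (counting_geP C 1%N).1; first by rewrite C1.
have fC : finite_set C by apply: counting_lty; rewrite C1 ltry.
exists (y ord0); apply/seteqP; split => [x Cx|_ -> //]; apply: contrapT => xy.
have := @counting_lt _ [set y ord0] C x _ fC Cx xy.
rewrite C1 countingE esum_set1// ltxx => H.
by have : false by apply: H => _ ->.
Qed.

(* The labels are the rational intervals that isolate a point. *)
Lemma random_enumeration (A : T -> set R) : random_locally_finite A ->
  exists (E : rat * rat -> set T) (x : rat * rat -> T -> R),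
  [/\ forall i, measurable (E i), forall i, measurable_fun (E i) (x i) &
      forall w, A w = [set y | exists2 i, E i w & y = x i w]].
Proof.
move=> [lfA mA].
pose I (i : rat * rat) : set R := `]ratr i.1, ratr i.2[%classic.
have mI i : measurable (I i) by exact: measurable_itv.
pose x i w : R := xget 0 (A w `&` I i).
pose E i := [set w | npoints (A w) (I i) = 1%E].
have xE i w : E i w -> A w `&` I i = [set x i w].
  rewrite /E /npoints /= => /counting_eq1[y yE].
  have : (A w `&` I i) (x i w) by apply: xgetPex; exists y; rewrite yE.
  by rewrite yE => ->.
have mE i : measurable (E i).
  by rewrite -[E i]setTI; exact: (mA (I i) (mI i) measurableT [set 1%E]).
exists E, x; split => //.
  move=> i _ B mB.
  (* On [E i] the only point of the interval lies in [B] exactly when the interval meets [A w]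
     inside [B], which is a statement about a count. *)
  have -> : E i `&` x i @^-1` B = E i `&` [set w | (1 <=
    npoints (A w) (I i `&` B))%E].
    apply/seteqP; split => w [Ew H]; split => //.
      apply: (@counting_ge1 _ _ (x i w)).
      rewrite setIA xE//.
    have /counting_gt0[y] : (0 < npoints (A w) (I i `&` B))%E by exact: lt_le_trans H.
    by rewrite setIA xE// => -[-> ].
  apply: measurableI => //; rewrite -[X in measurable X]setTI.
  apply: emeasurable_fun_c_infty => //; apply: mA; exact: measurableI.
move=> w; apply/seteqP; split => [y Ay|y [i Ei ->]].
  have [i iE] := isolated_rat (lfA w) Ay.
  have Eiw : E i w by rewrite /E /npoints /= /I iE countingE esum_set1.
  by exists i => //; have := xE i w Eiw; rewrite {1}/I iE => /seteqP[/(_ y erefl)].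
have : (A w `&` I i) (x i w) by rewrite xE.
by case.
Qed.

(** Several labels may name the same point. The count is at least [m.+1] exactly when some tuple of
    [m.+1] active labels names pairwise distinct points of [B], and there are countably many
    tuples. *)
Lemma npoints_enumerated (J : countType) (E : J -> set T) (x : J -> T -> R) B :
  (forall i, measurable (E i)) -> (forall i, measurable_fun (E i) (x i)) ->
  measurable B ->
  measurable_fun setT (fun w => npoints [set y | exists2 i, E i w & y = x i w] B).
Proof.
move=> mE mx mB; pose S w := [set y | exists2 i, E i w & y = x i w].
rewrite -/S.
have NE w : npoints (S w) B =
    (\sum_(m <oo) (\1_[set w | (m.+1%:R%:E <= npoints (S w) B)%E] w)%:E)%E.
  rewrite {1}/npoints counting_layer; apply: eq_eseriesr => m _.
  by rewrite indicE; case: ifPn => h; [rewrite mem_set|rewrite memNset// => /= h';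
    rewrite h' in h].
apply: (eq_measurable_fun (fun w => \sum_(m <oo) (\1_[set w | (m.+1%:R%:E <=
  npoints (S w) B)%E] w)%:E)%E).
  by move=> w _; rewrite -NE.
apply: ge0_emeasurable_sum; first by move=> *; rewrite lee_fin.
move=> m _; apply/measurable_EFinP/measurable_indic.
rewrite [X in measurable X](_ : _ = \bigcup_(t : m.+1.-tuple J)
  ((\bigcap_(i : 'I_m.+1) (E (tnth t i) `&` x (tnth t i) @^-1` B)) `&`
   (\bigcap_(ij in [set ij : 'I_m.+1 * 'I_m.+1 | ij.1 != ij.2])
     (E (tnth t ij.1) `&` E (tnth t ij.2) `&`
     [set w | x (tnth t ij.1) w - x (tnth t ij.2) w != 0])))).
  apply: countable_bigcupT_measurable => [|t]; first exact: countableP.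
  apply: measurableI.
    apply: fin_bigcap_measurable => // i _.
    by apply: mx.
  apply: fin_bigcap_measurable => // -[i j] /= _.
  have mEE : measurable (E (tnth t i) `&` E (tnth t j)) by exact: measurableI.
  have mB' : measurable_fun (E (tnth t i) `&` E (tnth t j))
      (fun w => x (tnth t i) w - x (tnth t j) w).
    apply: measurable_funB.
      by apply: measurable_funS (mx _); [exact: mE|exact: subIsetl].
    by apply: measurable_funS (mx _); [exact: mE|exact: subIsetr].
  have := mB' mEE (~` [set 0]) (measurableC (measurable_set1 _)).
  by congr (measurable _); apply/seteqP; split => w /= [? h]; split => //; exact/eqP.
apply/seteqP; split => w /=.
  move/counting_geP => [y yinj Sy].
  have [t tE] : exists t : m.+1.-tuple J, forall i, E (tnth t i) w /\ y i =
    x (tnth t i) w.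
    have /choice[f fE] : forall i, exists j, E j w /\ y i = x j w.
      by move=> i; have [[j Ej ->] _] := Sy i; exists j.
    by exists [tuple of mkseq (fun k => f (inord k)) m.+1] => i;
      rewrite (tnth_nth (f i)) nth_mkseq// inord_val.
  exists t => //; split.
    by move=> i _; have [? yE] := tE i; split => //=; rewrite -yE; have [] := Sy i.
  move=> [i j] /= ij; split; first by split; [exact: (tE i).1|exact: (tE j).1].
  rewrite subr_eq0 -(tE i).2 -(tE j).2; apply: contra ij => /eqP/yinj ->//.
move=> [t _ [tE tD]]; apply/counting_geP; exists (fun i => x (tnth t i) w).
  move=> i j xij; apply/eqP/negPn/negP => ij.
  by have [_] := tD (i, j) ij; rewrite /= xij subrr eqxx.
by move=> i; have [? ?] := tE i I; split => //; exists (tnth t i).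
Qed.

Section kth.
Variable A : T -> set R.
Hypothesis rA : random_locally_finite A.
Hypothesis A0 : forall w, A w `<=` [set x | 0 <= x].
Variable k : nat.
Hypothesis k0 : (0 < k)%N.

Definition has_kth := [set w | exists z, is_kth_point (A w) k z].

Let count_ge t := [set w | (k%:R%:E <= npoints (A w) `]-oo, t])%E].

Let mcount t : measurable (count_ge t).
Proof.
rewrite -[X in measurable X]setTI.
by apply: emeasurable_fun_c_infty => //; exact: rA.2.
Qed.

Lemma measurable_has_kth : measurable has_kth.
Proof.
rewrite (_ : has_kth = \bigcup_(n : nat) count_ge n%:R).
  exact: bigcupT_measurable.
apply/seteqP; split => [w [z kz]|w [n _]].
  exists (Num.truncn z).+1 => //; apply/(kth_point_le _ (rA.1 w) (@A0 w) k0).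
  by exists z; split => //; rewrite ltW// truncnS_gt.
by move=> /(kth_point_le _ (rA.1 w) (@A0 w) k0)[z [kz _]]; exists z.
Qed.

Lemma measurable_kth_point :
  measurable_fun has_kth (fun w => kth_point (A w) k).
Proof.
move=> mD; apply: (measurability _ (RGenOInfty.measurableE R)) => //.
move=> _ [_ [t ->] <-].
rewrite (_ : _ `&` _ = has_kth `\` count_ge t).
  by apply: measurableD; [exact: measurable_has_kth|exact: mcount].
apply/seteqP; split => w [Ew H]; split => //.
  move/(kth_point_le _ (rA.1 w) (@A0 w) k0) => [z [kz zt]].
  move: H; rewrite /= in_itv /= andbT => /lt_le_trans /(_ (lexx _)).
  rewrite (is_kth_point_inj (rA.1 w) (@A0 w) (kth_pointP Ew) kz).
  by rewrite ltNge zt.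
rewrite /= in_itv /= andbT ltNge; apply/negP => zt; apply: H.
apply/(kth_point_le _ (rA.1 w) (@A0 w) k0); exists (kth_point (A w) k).
by split => //; exact: kth_pointP.
Qed.
End kth.
End random_sets.

(** * Sums over point sets and comparison of integrals off null sets *)

Section sums.
Context (R : realType).

Lemma le_esum_subset (T : choiceType) (A B : set T) (f : T -> \bar R) :
  A `<=` B -> (forall x, 0 <= f x)%E -> (\esum_(x in A) f x <= \esum_(x in B) f x)%E.
Proof.
move=> AB f0; rewrite (esum_mkcond A) (esum_mkcond B).
apply: le_esum => x _; case: ifPn => [/set_mem/AB/mem_set ->//|_].
by case: ifP.
Qed.

(** The sets may overlap, so the union is first rewritten as one of disjoint smaller sets. *)
Lemma esum_bigcup_le (T : choiceType) (S : (set T)^nat) (f : T -> \bar R) :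
  (forall x, 0 <= f x)%E ->
  (\esum_(x in \bigcup_k S k) f x <= \sum_(k <oo) \esum_(x in S k) f x)%E.
Proof.
move=> f0; rewrite seqDU_bigcup_eq nneseries_sum_bigcup//.
apply: lee_nneseries => [k _ _|k _]; first exact: esum_ge0.
by apply: le_esum_subset => //; exact: subset_seqDU.
Qed.

Lemma esum_le_counting (A : set R) (f : R -> R) (c : R) : 0 <= c ->
  (forall x, A x -> f x <= c) -> (\esum_(x in A) (f x)%:E <= c%:E * counting A)%E.
Proof.
move=> c0 fc; apply: ub_ereal_sup => _ [B [fB BA] <-].
apply: (@le_trans _ _ (c%:E * counting B)%E); last first.
  by rewrite lee_wpmul2l ?lee_fin//; exact: le_counting.
rewrite counting_fin// fsbig_finite//=.
apply: (@le_trans _ _ (\sum_(x <- fset_set B) c%:E)%E).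
  rewrite big_seq [leRHS]big_seq; apply: lee_sum => x.
  by rewrite in_fset_set// inE => /BA/fc; rewrite lee_fin.
by rewrite sumEFin big_const_seq count_predT iter_addr_0 -EFinM mulr_natr.
Qed.

Lemma counting_bigcup (S : (set R)^nat) : trivIset setT S ->
  @counting R R (\bigcup_k S k) = (\sum_(k <oo) counting (S k))%E.
Proof.
move=> tS; rewrite countingE nneseries_sum_bigcup//.
by apply: eq_eseriesr => k _; rewrite countingE.
Qed.

Lemma counting_injW (A B : set R) (h : R -> R) : injective h ->
  (forall x, A x -> B (h x)) -> (@counting R R A <= counting B)%E.
Proof.
move=> hinj AB; have [->|[n cA]] := counting_natP B; first by rewrite leey.
have [cA'|[m cA']] := counting_natP A.
  rewrite leNgt; apply/negP => _.
  have /counting_geP[y yinj Ay] : (n.+1%:R%:E <=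
    @counting R R A)%E by rewrite cA' leey.
  have : (n.+1%:R%:E <= @counting R R B)%E.
    by apply/counting_geP; exists (h \o y) => [i j /hinj/yinj//|i]; exact: AB.
  by rewrite cA lee_fin ler_nat ltnn.
have /counting_geP[y yinj Ay] : (m%:R%:E <= @counting R R A)%E by rewrite cA'.
rewrite cA'; apply/counting_geP; exists (h \o y) => [i j /hinj/yinj//|i].
exact: AB.
Qed.

(** Fits the listing [cell_start] of the lattice, where even indices are the cells to the right of 0
    and odd ones the cells to its left. *)
Lemma nneseries_parity_le (f : nat -> \bar R) (c : \bar R) :
  (forall j, 0 <= f j)%E ->
  (forall n, \sum_(0 <= i < n) (f i.*2 + f i.*2.+1) <= c)%E ->
  (\sum_(j <oo) f j <= c)%E.
Proof.
move=> f0 fc; apply: lime_le; first exact: is_cvg_nneseries.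
apply: nearW => n; apply: le_trans (fc n).
have E m : (\sum_(0 <= i < m) (f i.*2 + f i.*2.+1) = \sum_(0 <= j < m.*2) f j)%E.
  elim: m => [|m IH]; first by rewrite !big_nil.
  by rewrite doubleS !big_nat_recr//= IH addeA.
by rewrite E; apply: lee_sum_nneg_natr => //; lia.
Qed.

End sums.

Section almost_everywhere.
Context d (T : measurableType d) (R : realType) (mu : {measure set T -> \bar R}).

Lemma negligible_bigcup_count (J : countType) (F : J -> set T) :
  (forall j, mu.-negligible (F j)) -> mu.-negligible (\bigcup_j F j).
Proof.
move=> nF; pose F' n := if @choice.unpickle J n is Some j then F j else set0.
apply: (@negligibleS _ _ _ _ (\bigcup_n F' n)).
  by move=> w [j _ Fj]; exists (choice.pickle j) => //; rewrite /F' choice.pickleK.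
apply: negligible_bigcup => n; rewrite /F'; case: choice.unpickle => //.
exact: negligible_set0.
Qed.

(** The null set is cut out of the measurable function [f]; the comparison with [g] is then
    pointwise everywhere. *)
Lemma ge0_le_integral_off_null_l (N : set T) (f g : T -> \bar R) :
  mu.-negligible N -> measurable_fun setT f -> (forall w, 0 <= f w)%E ->
  (forall w, 0 <= g w)%E -> (forall w, ~ N w -> f w <= g w)%E ->
  (\int[mu]_w f w <= \int[mu]_w g w)%E.
Proof.
move=> [M [mM M0 NM]] mf f0 g0 fg.
rewrite (@ge0_negligible_integral _ _ _ _ _ M)//.
rewrite integral_mkcond; apply: ge0_le_integralT => x; rewrite /patch;
  case: ifPn => //.
by move=> /set_mem[_ xM]; apply: fg => /NM.
Qed.

(** Here [g] is the measurable side: raising it to [+oo] on a null set keeps its integral and makes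
    the inequality hold everywhere. *)
Lemma ge0_le_integral_off_null_r (N : set T) (f g : T -> \bar R) :
  mu.-negligible N -> measurable_fun setT g -> (forall w, 0 <= f w)%E ->
  (forall w, 0 <= g w)%E -> (forall w, ~ N w -> f w <= g w)%E ->
  (\int[mu]_w f w <= \int[mu]_w g w)%E.
Proof.
move=> [M [mM M0 NM]] mg f0 g0 fg.
pose g' w := (g w + (cst +oo \_ M) w)%E.
have mc : measurable_fun setT (cst +oo%E \_ M : T -> \bar R).
  by apply/(measurable_restrictT _ mM); exact: measurable_cst.
have c0 w : (0 <= (cst +oo%E \_ M) w :> \bar R)%E by rewrite /patch; case: ifP;
  rewrite ?leey.
apply: (@le_trans _ _ (\int[mu]_w g' w)%E).
  apply: ge0_le_integralT => // w; rewrite /g' /patch; case: ifPn => [_|].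
    by rewrite addey ?leey// gt_eqF// (lt_le_trans _ (g0 w)).
  by rewrite adde0 notin_setE => Mw; apply: fg => /NM.
rewrite ge0_integralD// -[X in (_ + X)%E]integral_mkcond.
by rewrite integral_cst//= M0 mule0 adde0.
Qed.
End almost_everywhere.

(** * One generation step *)

Lemma integral_indicT d (T : measurableType d) (R : realType)
    (mu : {measure set T -> \bar R}) (A : set T) : measurable A ->
  (\int[mu]_w (\1_A w)%:E = mu A)%E.
Proof. by move=> mA; rewrite integral_indic// setIT. Qed.

(** The whole set is discarded when it is not locally finite, so that local finiteness holds for
    every realization and ranks are always available. *)
Definition clip (R : realType) (A : set R) : set R :=
  [set x | A x /\ locally_finite A].

Lemma clip_locally_finite (R : realType) (A : set R) : locally_finite (clip A).
Proof.
move=> a b; have [lfA|nlf] := pselect (locally_finite A).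
  by apply: sub_finite_set (lfA a b) => x [[]].
by rewrite (_ : _ `&` _ = set0)// -subset0 => x [[_ /nlf]].
Qed.

Lemma clip_id (R : realType) (A : set R) : locally_finite A -> clip A = A.
Proof. by move=> lfA; apply/seteqP; split => x //= []. Qed.

Definition children (R : realType) (A : set R) (B : nat -> set R) : set R :=
  [set y | exists k z, [/\ (0 < k)%N, is_kth_point A k z & offspring (B k) z y]].

(** Local finiteness is an event: it amounts to finite counts on the intervals from [-n] to [n]. *)
Lemma random_clip d (T : measurableType d) (R : realType) (C : T -> set R) :
  (forall B, measurable B -> measurable_fun setT (fun w => npoints (C w) B)) ->
  random_locally_finite (fun w => clip (C w)).
Proof.
move=> mC; split => [w|B mB]; first exact: clip_locally_finite.
pose L := \bigcap_n [set w | (npoints (C w) `[(- n%:R)%R, n%:R%R] < +oo)%E].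
have LE w : L w <-> locally_finite (C w).
  split => [Lw a b|lfC n _]; last first.
    by rewrite /= /npoints counting_fin ?ltry//; exact: lfC.
  pose n := (Num.truncn (Num.max `|a| `|b|)).+1.
  apply: sub_finite_set (counting_lty (Lw n I)) => x [Cx]; split => //.
  have := truncnS_gt (Num.max `|a| `|b|); rewrite -/n gt_max => /andP[an bn].
  move: an bn b0; rewrite /= !in_itv /= !ltr_norml =>
    /andP[? ?] /andP[? ?] /andP[? ?].
  by apply/andP; split; lra.
have mL : measurable L.
  apply: bigcapT_measurable => n; rewrite -[X in measurable X]setTI.
  by apply: emeasurable_fun_infty_o => //; exact: mC.
apply: (eq_measurable_fun (fun w => npoints (C w) B * (\1_L w)%:E)%E); last first.
  apply: emeasurable_funM; first exact: mC.
  by apply/measurable_EFinP; exact: measurable_indic.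
move=> w _; rewrite indicE; case: (boolP (w \in L)) => [/set_mem/LE lfC|].
  by rewrite clip_id// mule1.
rewrite notin_setE => nL; rewrite mule0 /npoints (_ : _ `&` _ = set0) ?counting0//.
by rewrite -subset0 => x [[_ /LE]].
Qed.

Section step.
Context d (T : measurableType d) (R : realType) (P : probability T R) (u : R).
Hypothesis u0 : 0 < u.
Context (I : choiceType) (D0 : set I) (drv : I -> T -> set R).
Hypothesis pppd : forall i, D0 i -> poisson_point_process P (zeta_intensity u)
  (drv i).
Hypothesis indd : mutually_independent P D0 (fun i => sigma_point_process (drv i)).

Definition history (D : set I) : set (set T) :=
  \bigcup_(i in D) sigma_point_process (drv i).

Local Notation F D := (g_sigma_algebraType (history D)).

Lemma history_measurable D : D `<=` D0 -> history D `<=` measurable.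
Proof.
by move=> DD0 E [i /DD0/pppd ppi]; exact: sigma_point_process_measurable ppi _.
Qed.

Lemma history_measurable_fun D D' d' (T' : measurableType d') (E : set T) (f : T ->
  T') :
  D `<=` D' -> measurable (E : set (F D)) ->
  measurable_fun (E : set (F D)) f -> measurable_fun (E : set (F D')) f.
Proof.
move=> DD' mE mf _ B mB.
have sub : <<s history D >> `<=` <<s history D' >>.
  by apply: sub_sigma_algebra2; exact: bigcup_subset.
by apply: sub; exact: mf.
Qed.

Lemma history_measurable_set D D' (E : set T) : D `<=` D' ->
  measurable (E : set (F D)) -> measurable (E : set (F D')).
Proof.
by move=> DD'; apply: sub_sigma_algebra2; exact: bigcup_subset.
Qed.

Lemma history_measurable_setT D (E : set T) : D `<=` D0 ->
  measurable (E : set (F D)) -> measurable E.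
Proof. by move=> DD0; apply: g_sigma_measurable; exact: history_measurable. Qed.

Lemma history_measurable_funT D d' (T' : measurableType d') (f : T -> T') :
  D `<=` D0 -> measurable_fun (setT : set (F D)) f -> measurable_fun setT f.
Proof. by move=> DD0; apply: g_sigma_measurable_funT; exact: history_measurable. Qed.

Lemma driver_random D i : D0 i -> D i ->
  @random_locally_finite _ (F D) R (drv i).
Proof.
move=> D0i Di; split; first exact: ppp_locally_finite (pppd D0i).
move=> B mB _ C mC; apply: sub_sigma_algebra; exists i => //.
by apply: sub_sigma_algebra; exists B => //; exists C.
Qed.

Lemma random_subset D D' (A : T -> set R) : D `<=` D' ->
  @random_locally_finite _ (F D) R A -> @random_locally_finite _ (F D') R A.
Proof.
move=> DD' [lfA mA]; split => // B mB.
by apply: (history_measurable_fun DD') => //; exact: mA.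
Qed.

(** Takes the place of conditioning on the past: [f] depends on the drivers in [D], and the driver
    [i] is fresh. *)
Lemma integral_history_driver D i (f : T -> \bar R) (a b : R) :
  D `<=` D0 -> D0 i -> ~ D i -> a <= b ->
  measurable_fun (setT : set (F D)) f -> (forall w, 0 <= f w)%E ->
  (\int[P]_w (f w * npoints (drv i w) `[a, b[) =
    \int[P]_w f w * zeta_intensity u `[a, b[)%E.
Proof.
move=> DD0 D0i nDi ab mf f0.
apply: (integral_npoints_independent u0 (pppd D0i) ab (history_measurable DD0)) => //.
move=> E B sE sB.
apply: (independent_sigma_bigcup indd _ _ DD0 D0i nDi sE sB).
  by move=> j _; exact: smallest_sigma_algebra.
by move=> j D0j; exact: sigma_point_process_measurable (pppd D0j).
Qed.

(** At each scale the cells are disjoint, so the bounds for the single cells add up to at most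
    [u / m.+1], which is arbitrarily small. *)
Lemma independent_avoids D i (E : set T) (U : T -> R) :
  D `<=` D0 -> D0 i -> ~ D i -> measurable (E : set (F D)) ->
  measurable_fun (E : set (F D)) U ->
  P.-negligible [set w | E w /\ drv i w (U w)].
Proof.
move=> DD0 D0i nDi mE mU.
(* The probability that [U] lies in a cell of length [1 / m.+1] that meets
   [drv i] is at most [u / m.+1]. *)
pose cell (r m t : nat) : set R := `[- r%:R + t%:R / m.+1%:R,
  - r%:R + t.+1%:R / m.+1%:R[%classic.
pose H r m t := E `&` U @^-1` cell r m t.
have mH r m t : measurable (H r m t : set (F D)) by apply: mU => //;
  exact: measurable_itv.
pose K r m t := H r m t `&` [set w | (1 <= npoints (drv i w) (cell r m t))%E].
have mK r m t : measurable (K r m t).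
  apply: measurableI; first exact: history_measurable_setT (mH r m t).
  rewrite -[X in measurable X]setTI; apply: emeasurable_fun_c_infty => //.
  by apply: (ppp_measurable (pppd D0i)); exact: measurable_itv.
have PK r m t : (P (K r m t) <= P (H r m t) * (u / m.+1%:R)%:E)%E.
  have cE : - r%:R + t%:R / m.+1%:R <= - r%:R + t.+1%:R / m.+1%:R :> R.
    by rewrite lerD2l ler_pM2r ?invr_gt0// ler_nat.
  rewrite -[P (H r m t)]integral_indicT;
    last exact: history_measurable_setT (mH r m t).
  apply: (@le_trans _ _ (\int[P]_w (\1_(H r m t) w)%:E * zeta_intensity u (cell r
    m t))%E); last first.
    apply: lee_wpmul2l; first by apply: integral_ge0 => w _; rewrite lee_fin.
    apply: (le_trans (zeta_intensity_le1 u0 cE)).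
    by rewrite lee_fin ler_pM2l// opprD addrACA addrN add0r -mulrBl -natrB//
      subSnn mul1r.
  rewrite -(@integral_history_driver D i (fun w => (\1_(H r m t) w)%:E))//;
    last first.
    by apply/measurable_EFinP; exact: measurable_indic.
  rewrite -integral_indicT//; apply: ge0_le_integralT => w; rewrite ?lee_fin//.
  rewrite !indicE; case: (boolP (w \in K r m t)) => [/set_mem[Hw Kw]|_].
    by rewrite mem_set// mul1e.
  by rewrite mule_ge0// ?lee_fin// counting_ge0.
apply: (@negligibleS _ _ _ _ (\bigcup_r \bigcap_m \bigcup_t K r m t)).
  move=> w [Ew dUw].
  (* The lattice starts at [- r], to the left of [U w], so that its cells can be indexed by natural
     numbers. *)
  exists (Num.truncn `|U w|).+1 => // m _.
  set r := (Num.truncn `|U w|).+1.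
  have Ur : 0 <= U w + r%:R.
    by have := truncnS_gt `|U w|; rewrite -/r ltr_norml => /andP[? _]; lra.
  exists (Num.truncn ((U w + r%:R) * m.+1%:R)) => //.
  have cellU : cell r m (Num.truncn ((U w + r%:R) * m.+1%:R)) (U w).
    have m0 : 0 < m.+1%:R :> R by [].
    rewrite /cell /= in_itv /= -lerBrDl -ltrBlDl opprK ler_pdivrMr// ltr_pdivlMr//.
    by rewrite truncnS_gt andbT truncn_le// mulr_ge0.
  by split => //; apply: (@counting_ge1 _ _ (U w)).
apply: negligible_bigcup => r.
have mB : measurable (\bigcap_m \bigcup_t K r m t).
  by apply: bigcapT_measurable => m; exact: bigcupT_measurable.
apply/negligibleP => //; apply/eqP; rewrite eq_le measure_ge0 andbT.
apply/lee_addgt0Pr => e e0; rewrite add0e.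
pose m := Num.truncn (u / e).
have ume : u / m.+1%:R <= e.
  by rewrite ler_pdivrMr// mulrC -ler_pdivrMr// ltW// truncnS_gt.
apply: (@le_trans _ _ (P (\bigcup_t K r m t))).
  by apply: le_measure; rewrite ?inE//; [exact: bigcupT_measurable|move=> w; exact].
apply: (@le_trans _ _ (\sum_(t <oo) P (K r m t))%E).
  apply: measure_sigma_subadditive => //; exact: bigcupT_measurable.
apply: (@le_trans _ _ (\sum_(t <oo) (u / m.+1%:R)%:E * P (H r m t))%E).
  by apply: lee_nneseries => // t _; rewrite muleC; exact: PK.
have um0 : 0 <= u / m.+1%:R by rewrite divr_ge0// ltW.
rewrite nneseriesZl//.
rewrite (_ : (\sum_(t <oo) P (H r m t))%E = P (\bigcup_t H r m t)); last first.
  rewrite measure_bigcup//=.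
  - by apply: eq_eseriesl => t; rewrite in_setT.
  - by move=> t _; exact: history_measurable_setT (mH r m t).
  - apply/trivIsetP => t t' _ _ tt'; rewrite -subset0 => w [[_ Ht] [_ Ht']].
    move: Ht Ht' tt'; rewrite /cell /= !in_itv /= => /andP[h1 h2] /andP[h3 h4].
    have := le_lt_trans h1 h4; have := le_lt_trans h3 h2.
    rewrite !ltrD2l !ltr_pM2r ?invr_gt0// !ltr_nat !ltnS => ? ?.
    by rewrite eqn_leq; apply/negP/negPn/andP; split.
apply: (@le_trans _ _ ((u / m.+1%:R)%:E * 1)%E).
  apply: lee_wpmul2l; rewrite ?lee_fin//; apply: probability_le1.
  by apply: bigcupT_measurable => t; exact: history_measurable_setT (mH r m t).
by rewrite mule1 lee_fin.
Qed.
Section generation.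
Variables (D : set I) (A : T -> set R) (iota : nat -> I).
Hypothesis DD0 : D `<=` D0.
Hypothesis rA : @random_locally_finite _ (F D) R A.
Hypothesis A0 : forall w, A w `<=` [set x | 0 <= x].
Hypothesis iotaD0 : forall k, (0 < k)%N -> D0 (iota k).
Hypothesis iotaD : forall k, (0 < k)%N -> ~ D (iota k).

Let D' := D `|` iota @` [set k | (0 < k)%N].
Let Z k w := kth_point (A w) k.
Let H k := has_kth A k.

Definition next_generation w := children (A w) (fun k => drv (iota k) w).

Definition brood k w : set R :=
  [set y | exists2 z, is_kth_point (A w) k z & offspring (drv (iota k) w) z y].

Lemma next_generation_brood w : next_generation w = \bigcup_k brood k.+1 w.
Proof.
apply/seteqP; split => [y [[|k] [z [//= _ kz yz]]]|y [k _ [z kz yz]]].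
  by exists k => //; exists z.
by exists k.+1, z.
Qed.

Let ZE k w z : is_kth_point (A w) k z -> z = Z k w.
Proof. exact: kth_pointE (rA.1 w) (@A0 w). Qed.

Let mH k : (0 < k)%N -> measurable (H k : set (F D)).
Proof. exact: measurable_has_kth rA A0 k. Qed.

Let mZ k : (0 < k)%N -> measurable_fun (H k : set (F D)) (Z k).
Proof. exact: measurable_kth_point rA A0 k. Qed.

(** A child is labelled by the rank of its parent and the label of its displacement in the
    enumeration of the driver; its position is then a sum of two measurable functions. *)
Lemma next_generation_measurable B : measurable B ->
  measurable_fun (setT : set (F D')) (fun w => npoints (next_generation w) B).
Proof.
move=> mB.
have subD : D `<=` D' by exact: subsetUl.
have enum k : exists Ex : (rat * rat -> set T) * (rat * rat -> T -> R), (0 < k)%N ->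
    [/\ forall i, measurable (Ex.1 i : set (F D')),
      forall i, measurable_fun (Ex.1 i : set (F D')) (Ex.2 i) &
      forall w, drv (iota k) w = [set y | exists2 i, Ex.1 i w & y = Ex.2 i w]].
  have [k0|k0] := boolP (0 < k)%N; last first.
    by exists (fun=> set0, fun=> cst 0).
  have Dk : D' (iota k) by right; exists k.
  have [E [x [mE mx Ex]]] := random_enumeration (driver_random (iotaD0 k0) Dk).
  by exists (E, x).
have {enum}/choice[Ex ExP] := enum.
pose G (j : nat * (rat * rat)) : set T := H j.1 `&` (Ex j.1).1 j.2.
pose y (j : nat * (rat * rat)) w : R := (Ex j.1).2 j.2 w + Z j.1 w.
have mG j : (0 < j.1)%N -> measurable (G j : set (F D')).
  move=> j0; have [mE _ _] := ExP _ j0; apply: measurableI => //.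
  exact: history_measurable_set (mH j0).
have my j : (0 < j.1)%N -> measurable_fun (G j : set (F D')) (y j).
  move=> j0; have [mE mx _] := ExP _ j0; apply: measurable_funD.
    by apply: measurable_funS (mx _); [exact: mE|exact: subIsetr].
  apply: measurable_funS (history_measurable_fun subD (mH j0) (mZ j0)).
    exact: history_measurable_set (mH j0).
  exact: subIsetl.
(* The barrier at 0 becomes part of the event that the label is active; labels of rank 0 are never
   active. *)
pose E (j : nat * (rat * rat)) : set T :=
  if (0 < j.1)%N then G j `&` y j @^-1` `[0, +oo[%classic else set0.
have -> : (fun w => npoints (next_generation w) B) =
    (fun w => npoints [set v | exists2 j, E j w & v = y j w] B).
  apply/funext => w; congr npoints; apply/seteqP; split => v.
    move=> [k [z [k0 kz [x dx [-> y0]]]]].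
    have [_ _ dE] := ExP _ k0; move: dx; rewrite dE => -[i Ei xE].
    exists (k, i); last by rewrite /y /= -xE -(ZE kz).
    rewrite /E /= k0; split; first by split => //=; exists z.
    by rewrite /= in_itv /= andbT /y /= -xE -(ZE kz).
  move=> [[k i]]; rewrite /E /=; case: ifP => //= k0 [[Hk Ei]].
  rewrite in_itv /= andbT => y0 ->; exists k, (Z k w); split => //.
    exact: kth_pointP.
  have [_ _ dE] := ExP _ k0; exists ((Ex k).2 i w) => //.
  by rewrite dE; exists i.
apply: npoints_enumerated => // j; rewrite /E; case: ifP => // j0.
- by apply: (my j j0 (mG j j0)); exact: measurable_itv.
- apply: measurable_funS (my j j0); first exact: mG.
  exact: subIsetl.
- by move=> _ C mC; rewrite set0I.
Qed.

Lemma next_generation_clip_random :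
  @random_locally_finite _ (F D') R (fun w => clip (next_generation w)).
Proof. by apply: random_clip; exact: next_generation_measurable. Qed.

Lemma next_generation_ge0 w : next_generation w `<=` [set x | 0 <= x].
Proof. by move=> y [k [z [_ _ [x _ []]]]]. Qed.

Lemma npoints_kth w B : npoints (A w) B =
  (\sum_(k <oo) (\1_(H k.+1 `&` Z k.+1 @^-1` B) w)%:E)%E.
Proof.
pose S k := [set z | is_kth_point (A w) k.+1 z] `&` B.
have -> : npoints (A w) B = counting (\bigcup_k S k).
  congr counting; apply/seteqP; split => [z [Az Bz]|z [k _ [[Az _] Bz]]]; last by [].
  by have [[//|k] _ kz] := point_is_kth (rA.1 w) (@A0 w) Az; exists k.
rewrite counting_bigcup; last first.
  apply/trivIsetP => k l _ _ kl; rewrite -subset0 => z [[kz _] [lz _]].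
  by move/eqP: kl; apply; exact: (succn_inj (is_kth_point_rank kz lz)).
apply: eq_eseriesr => k _; rewrite indicE.
case: (boolP (w \in _)) => [/set_mem[Hk BZ]|].
  rewrite countingE (_ : S k = [set Z k.+1 w]) ?esum_set1//.
  apply/seteqP; split => [z [/ZE]//|_ ->]; split => //; exact: kth_pointP.
rewrite notin_setE => nHB; rewrite (_ : S k = set0) ?counting0//.
rewrite -subset0 => z [kz Bz]; apply: nHB; split; first by exists z.
by rewrite /= -(ZE kz).
Qed.

(** If a child of parent [k] meets a child of parent [l] with displacement [x], then driver [k]
    contains [x + Z l - Z k]. This position depends only on the past and on driver [l], and
    countably many labels cover all such [x]. *)
Lemma broods_disjoint :
  (forall k l, (0 < k)%N -> (0 < l)%N -> iota k = iota l -> k = l) ->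
  P.-negligible [set w | ~ trivIset setT (fun k => brood k.+1 w)].
Proof.
move=> iinj.
have subl l : (0 < l)%N -> D `|` [set iota l] `<=` D0.
  by move=> l0 i [/DD0//|->]; exact: iotaD0.
have enum l : exists Ex : (rat * rat -> set T) * (rat * rat -> T -> R), (0 < l)%N ->
    [/\ forall i, measurable (Ex.1 i : set (F (D `|` [set iota l]))),
      forall i, measurable_fun (Ex.1 i : set (F (D `|` [set iota l]))) (Ex.2 i) &
      forall w, drv (iota l) w = [set y | exists2 i, Ex.1 i w & y = Ex.2 i w]].
  have [l0|l0] := boolP (0 < l)%N; last first.
    by exists (fun=> set0, fun=> cst 0).
  have [|E [x [mE mx Ex]]] := random_enumeration (@driver_random (D `|` [set iota
    l]) _ (iotaD0 l0) _).
    by right.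
  by exists (E, x).
have {enum}/choice[Ex ExP] := enum.
pose U (k l : nat) i w := (Ex l).2 i w + Z l w - Z k w.
pose E (k l : nat) i := H k `&` H l `&` (Ex l).1 i.
apply: (@negligibleS _ _ _ _ (\bigcup_(j : nat * nat * (rat * rat))
  [set w | j.1.1 != j.1.2 /\ E j.1.1.+1 j.1.2.+1 j.2 w /\
           drv (iota j.1.1.+1) w (U j.1.1.+1 j.1.2.+1 j.2 w)])).
  move=> w /= nt; apply: contrapT => nw; apply: nt.
  apply/trivIsetP => k l _ _ kl; rewrite -subset0 =>
    y [[z kz [x dx [-> _]]] [z' lz' [x' dx' [xE _]]]].
  have [_ _ dE] := ExP l.+1 isT; move: dx'; rewrite dE => -[i Ei x'E].
  apply: nw; exists (k, l, i) => //=; split => //; split.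
    by split => //; split; [exists z|exists z'].
  by rewrite /U -x'E -(ZE kz) -(ZE lz') -xE addrK.
apply: negligible_bigcup_count => -[[k l] i] /=.
have [kl|kl] := eqVneq k l.
  by rewrite (_ : mkset _ = set0); [exact: negligible_set0|rewrite -subset0 => w []].
apply: (@negligibleS _ _ _ _ [set w | E k.+1 l.+1 i w /\ drv (iota k.+1) w (U
  k.+1 l.+1 i w)]).
  by move=> w [_ []].
have [mE mx _] := ExP l.+1 isT.
have sD : D `<=` D `|` [set iota l.+1] by exact: subsetUl.
have mEkl : measurable (E k.+1 l.+1 i : set (F (D `|` [set iota l.+1]))).
  by apply: measurableI => //; apply: measurableI;
    apply: (history_measurable_set sD); exact: mH.
apply: (@independent_avoids (D `|` [set iota l.+1])) => //.
- exact: subl.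
- exact: iotaD0.
- move=> [|/= /iinj kl']; first exact: iotaD.
  by move/negP: kl; apply; rewrite -eqSS kl'.
- have mZ' j : measurable_fun (H j.+1 : set (F (D `|` [set iota l.+1]))) (Z j.+1).
    by apply: (history_measurable_fun sD); [exact: mH|exact: mZ].
  apply: measurable_funB; first apply: measurable_funD.
  + by apply: measurable_funS (mx i) => //; exact: subIsetr.
  + apply: measurable_funS (mZ' l); last by move=> w [[]].
    by apply: (history_measurable_set sD); exact: mH.
  + apply: measurable_funS (mZ' k); last by move=> w [[]].
    by apply: (history_measurable_set sD); exact: mH.
Qed.

End generation.
End step.

(** * Moment bounds for one step *)

Definition exp_sum (R : realType) (alpha : R) (A : set R) : \bar R :=
  \esum_(x in A) (expR (- alpha * x))%:E.

Lemma exp_sum_ge0 (R : realType) (alpha : R) (A : set R) : (0 <= exp_sum alpha A)%E.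
Proof. by apply: esum_ge0 => x _; rewrite lee_fin expR_ge0. Qed.

Lemma counting_le_esum (R : realType) (A : set R) (f : R -> R) (c : R) : 0 < c ->
  (forall x, A x -> c <= f x) -> (c%:E * counting A <= \esum_(x in A) (f x)%:E)%E.
Proof.
move=> c0 cf.
have H n : (n%:R%:E <= @counting R R A)%E -> ((c * n%:R)%:E <=
  \esum_(x in A) (f x)%:E)%E.
  move=> /counting_geP[y yinj Ay]; apply: esum_ge.
  exists [set` [fset y i | i in 'I_n]%fset].
    by split => // x /= /imfsetP[i _ ->].
  rewrite fsbig_finite//= set_fsetK.
  apply: (@le_trans _ _ (\sum_(x <- [fset y i | i in 'I_n]%fset) c%:E)%E).
    rewrite sumEFin big_const_seq count_predT iter_addr_0 card_imfset//=.
    by rewrite size_enum_ord mulr_natr.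
  rewrite big_seq [leRHS]big_seq; apply: lee_sum => x /imfsetP[i _ ->].
  by rewrite lee_fin; exact: cf.
have [cA|[n cA]] := counting_natP A; last by rewrite cA -EFinM; apply: H; rewrite cA.
rewrite [leRHS](_ : _ = +oo%E) ?leey//; apply/eqyP => r r0.
apply: (@le_trans _ _ (c * (Num.truncn (r / c)).+1%:R)%:E); last by apply: H;
  rewrite cA leey.
by rewrite lee_fin mulrC -ler_pdivrMr// ltW// truncnS_gt.
Qed.

Lemma npoints_le_exp_sum (R : realType) (alpha r : R) (A : set R) : 0 <= alpha ->
  (npoints A `[0%R, r] <= (expR (alpha * r))%:E * exp_sum alpha A)%E.
Proof.
move=> a0.
have : ((expR (- alpha * r))%:E * npoints A `[0%R, r] <= exp_sum alpha A)%E.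
  apply: (@le_trans _ _ (\esum_(x in A `&` `[0%R, r]) (expR (- alpha * x))%:E)).
    apply: counting_le_esum; first exact: expR_gt0.
    move=> x [_]; rewrite /= in_itv /= => /andP[_ xr].
    by rewrite ler_expR !mulNr lerN2 ler_wpM2l.
  apply: le_esum_subset => x; first by case.
  by rewrite lee_fin expR_ge0.
move=> /(lee_wpmul2l (x := (expR (alpha * r))%:E));
  rewrite lee_fin expR_ge0 => /(_ isT).
by rewrite muleA -EFinM -expRD mulNr addrN expR0 mul1e.
Qed.

Section cells.
Context (R : realType) (eta : R).
Hypothesis eta0 : 0 < eta.

(* The lattice eta * Z, listed as 0, -eta, eta, -2 eta, 2 eta, etc. *)
Definition cell_start (j : nat) : R :=
  eta * (if odd j then - (j./2.+1)%:R else j./2%:R).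

Lemma cell_start_cover x : exists j, cell_start j <= x < cell_start j + eta.
Proof.
have [f1 f2] : (Num.floor (x / eta))%:~R * eta <= x /\
    x < (Num.floor (x / eta))%:~R * eta + eta.
  have /andP[h1 h2] := floor_itv (x / eta).
  rewrite -ler_pdivlMr// h1; split => //.
  by move: h2; rewrite ltr_pdivrMr// intrD mulrDl mul1r.
move: (Num.floor _) f1 f2 => [n|n] f1 f2.
  exists n.*2; rewrite /cell_start odd_double doubleK mulrC.
  by rewrite f1.
exists n.*2.+1; rewrite /cell_start /= odd_double /= uphalf_double mulrC.
by move: f1 f2; rewrite NegzE mulrNz => -> ->.
Qed.

Lemma geometric_sum_le (q : R) n : 0 <= q -> q < 1 ->
  \sum_(0 <= i < n) q ^+ i <= (1 - q)^-1.
Proof.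
move=> q0 q1; have q10 : 0 < 1 - q by rewrite subr_gt0.
rewrite -[leRHS]mul1r ler_pdivlMr// big_mkord -[leLHS]opprK -mulrN opprB mulrC
  -subrX1.
by rewrite opprB lerBlDr lerDl exprn_ge0.
Qed.

Variables (u alpha : R).
Hypothesis u0 : 0 < u.

(** An upper Riemann sum of mesh [eta] for [Lambda alpha], with the exponential taken at the left
    end of each cell. *)
Definition offspring_exp_bound : \bar R :=
  (\sum_(j <oo) (expR (- alpha * cell_start j))%:E *
    zeta_intensity u `[cell_start j, (cell_start j + eta)%R[)%E.

Lemma offspring_exp_bound_ge0 : (0 <= offspring_exp_bound)%E.
Proof.
apply: nneseries_ge0 => j _ _.
by rewrite mule_ge0 ?zeta_intensity_ge0 ?lee_fin ?expR_ge0.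
Qed.

(** Two geometric series: to the right of 0 the weight decays at rate [alpha], to the left the
    intensity beats the weight at rate [1 - alpha]. The factor exp (alpha * eta) comes from the left
    endpoints of the negative cells. As [eta] tends to 0 the bound tends to u / alpha + u / (1 -
    alpha), which is [Lambda alpha]. *)
Lemma offspring_exp_bound_le : 0 < alpha -> alpha < 1 ->
  (offspring_exp_bound <= (u * eta * ((1 - expR (- (alpha * eta)))^-1 +
    expR (alpha * eta) * (1 - expR (- ((1 - alpha) * eta)))^-1))%:E)%E.
Proof.
move=> a0 a1.
have zi0 j := zeta_intensity_ge0 u0 `[cell_start j, (cell_start j + eta)%R[.
apply: nneseries_parity_le => [j|n].
  by rewrite mule_ge0// lee_fin expR_ge0.
pose q := expR (- (alpha * eta)).
pose q' := expR (- ((1 - alpha) * eta)).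
have q1 : q < 1 by rewrite expR_lt1 oppr_lt0 mulr_gt0.
have q'1 : q' < 1 by rewrite expR_lt1 oppr_lt0 mulr_gt0// subr_gt0.
apply: (@le_trans _ _ (\sum_(0 <= i < n)
    ((u * eta * q ^+ i) + (u * eta * expR (alpha * eta) * q' ^+ i))%:E)%E).
  apply: lee_sum => i _; rewrite EFinD; apply: leeD.
    rewrite /cell_start odd_double doubleK.
    apply: (le_trans (lee_wpmul2l _ (zeta_intensity_le1 u0 _))).
    - by rewrite lee_fin expR_ge0.
    - by rewrite lerDl ltW.
    rewrite -EFinM lee_fin -expRM_natl le_eqVlt; apply/orP; left; apply/eqP.
    rewrite [X in expR X](_ : _ = (- (alpha * eta)) * i%:R); last by ring.
    by rewrite [i%:R * _]mulrC; ring.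
  have cE : cell_start i.*2.+1 = - (eta * i.+1%:R).
    by rewrite /cell_start /= odd_double /= uphalf_double mulrN.
  have cE' : cell_start i.*2.+1 + eta = - (eta * i%:R).
    by rewrite cE -natr1; ring.
  apply: (le_trans (lee_wpmul2l _ (zeta_intensity_le (c :=
    expR (- (eta * i%:R))) u0 _ _))).
  - by rewrite lee_fin expR_ge0.
  - by rewrite lerDl ltW.
  - by move=> x /andP[_]; rewrite cE' ler_expR => xi; rewrite ge_min (ltW xi) orbT.
  rewrite cE' cE -EFinM lee_fin -expRM_natl le_eqVlt; apply/orP; left; apply/eqP.
  have -> : u * expR (- (eta * i%:R)) * (- (eta * i%:R) - - (eta * i.+1%:R)) =
      u * eta * expR (- (eta * i%:R)) by rewrite -natr1; ring.
  rewrite mulrCA -mulrA -expRD -mulrA -expRD.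
  by rewrite -mulrA; congr (_ * (_ * expR _)); rewrite -natr1; ring.
rewrite sumEFin lee_fin big_split /= -!mulr_sumr -[X in _ + X <= _]mulrA -mulrDr.
apply: ler_wpM2l; first by rewrite mulr_ge0// ltW.
apply: lerD; first by apply: geometric_sum_le => //; exact: expR_ge0.
rewrite ler_wpM2l ?expR_ge0//.
by apply: geometric_sum_le => //; exact: expR_ge0.
Qed.
End cells.

Section step_bounds.
Context d (T : measurableType d) (R : realType) (P : probability T R) (u : R).
Hypothesis u0 : 0 < u.
Context (I : choiceType) (D0 : set I) (drv : I -> T -> set R).
Hypothesis pppd : forall i, D0 i -> poisson_point_process P (zeta_intensity u)
  (drv i).
Hypothesis indd : mutually_independent P D0 (fun i => sigma_point_process (drv i)).

Local Notation F D := (g_sigma_algebraType (history drv D)).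

Definition driver_weight (alpha eta : R) i w : \bar R :=
  (\sum_(j <oo) (expR (- alpha * cell_start eta j))%:E *
    npoints (drv i w) `[cell_start eta j, (cell_start eta j + eta)%R[)%E.

(** A translation by [z] factors out of the exponential. Asking only for an inclusion into the
    translate of [B] accommodates the barrier. *)
Lemma exp_sum_translate_le (alpha eta z : R) (B S : set R) : 0 < alpha -> 0 < eta ->
  (forall y, S y -> B (y - z)) ->
  (exp_sum alpha S <= (expR (- alpha * z))%:E *
    \sum_(j <oo) (expR (- alpha * cell_start eta j))%:E *
    npoints B `[cell_start eta j, (cell_start eta j + eta)%R[)%E.
Proof.
move=> a0 e0 SB.
pose J j : set R := S `&` [set y | cell_start eta j <=
  y - z < cell_start eta j + eta].
have -> : S = \bigcup_j J j.
  apply/seteqP; split => [y Sy|y [j _ []//]].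
  by have [j yj] := cell_start_cover e0 (y - z); exists j.
apply: (le_trans (esum_bigcup_le _ _)) => [x|]; first by rewrite lee_fin expR_ge0.
rewrite nneseriesZle; last 2 first.
- by rewrite lee_fin expR_ge0.
- by move=> j; rewrite mule_ge0 ?counting_ge0// lee_fin expR_ge0.
apply: lee_nneseries => [j _ _|j _].
  by apply: esum_ge0 => x _; rewrite lee_fin expR_ge0.
rewrite muleA -EFinM -expRD.
apply: (@le_trans _ _ ((expR (- alpha * z + - alpha * cell_start eta j))%:E *
  counting (J j))%E).
  apply: esum_le_counting; first exact: expR_ge0.
  move=> y [_] /= /andP[y1 _]; rewrite ler_expR -mulrDr !mulNr lerN2.
  by rewrite ler_pM2l//; lra.
apply: lee_wpmul2l; first by rewrite lee_fin expR_ge0.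
apply: (counting_injW (h := fun y => y - z)); first exact: addIr.
by move=> y [Sy yj]; split; [exact: SB|rewrite /= in_itv].
Qed.

Lemma driver_weight_ge0 alpha eta i w : (0 <= driver_weight alpha eta i w)%E.
Proof.
by apply: nneseries_ge0 => j _ _; rewrite mule_ge0 ?counting_ge0// lee_fin expR_ge0.
Qed.

Lemma driver_weight_measurable alpha eta i : D0 i ->
  measurable_fun setT (driver_weight alpha eta i).
Proof.
move=> D0i; apply: ge0_emeasurable_sum => [j w _ _|j _].
  by rewrite mule_ge0 ?counting_ge0// lee_fin expR_ge0.
apply: emeasurable_funM => //.
by apply: (ppp_measurable (pppd D0i)); exact: measurable_itv.
Qed.

Lemma integral_driver_weight alpha eta D i (f : T -> \bar R) : 0 < eta ->
  D `<=` D0 -> D0 i -> ~ D i ->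
  measurable_fun (setT : set (F D)) f -> (forall w, 0 <= f w)%E ->
  (\int[P]_w (f w * driver_weight alpha eta i w) =
    \int[P]_w f w * offspring_exp_bound eta u alpha)%E.
Proof.
move=> e0 DD0 D0i nDi mf f0.
have mfT := history_measurable_funT pppd DD0 mf.
have mN j : measurable_fun setT (fun w => npoints (drv i w) `[cell_start eta j,
  (cell_start eta j + eta)%R[).
  by apply: (ppp_measurable (pppd D0i)); exact: measurable_itv.
have e0' x : (0 <= (expR x)%:E :> \bar R)%E by rewrite lee_fin expR_ge0.
transitivity (\int[P]_w \sum_(j <oo) (expR (- alpha * cell_start eta j))%:E *
    (f w * npoints (drv i w) `[cell_start eta j, (cell_start eta j + eta)%R[))%E.
  apply: eq_integral => w _; rewrite nneseriesZle//.
    by apply: eq_eseriesr => j _; rewrite muleCA.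
  by move=> j; rewrite mule_ge0 ?counting_ge0.
rewrite integral_nneseries//; last 2 first.
- by move=> j; apply: emeasurable_funM => //; exact: emeasurable_funM.
- by move=> j w _; rewrite !mule_ge0 ?counting_ge0.
rewrite /offspring_exp_bound nneseriesZle; last 2 first.
- exact: integral_ge0.
- by move=> j; rewrite mule_ge0// zeta_intensity_ge0.
apply: eq_eseriesr => j _.
rewrite ge0_integralZl//; last 2 first.
- exact: emeasurable_funM.
- by move=> w _; rewrite mule_ge0 ?counting_ge0.
rewrite (integral_history_driver u0 pppd indd DD0)//; first by rewrite muleCA.
by rewrite lerDl ltW.
Qed.

Section generation_bounds.
Variables (D : set I) (A : T -> set R) (iota : nat -> I).
Hypothesis DD0 : D `<=` D0.
Hypothesis rA : @random_locally_finite _ (F D) R A.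
Hypothesis A0 : forall w, A w `<=` [set x | 0 <= x].
Hypothesis iotaD0 : forall k, (0 < k)%N -> D0 (iota k).
Hypothesis iotaD : forall k, (0 < k)%N -> ~ D (iota k).

Let Z k w := kth_point (A w) k.
Let H k := has_kth A k.
Let C := next_generation drv A iota.

Let ZE k w z : is_kth_point (A w) k z -> z = Z k w.
Proof. exact: kth_pointE (rA.1 w) (@A0 w). Qed.

Let mH k : (0 < k)%N -> measurable (H k : set (F D)).
Proof. exact: measurable_has_kth rA A0 k. Qed.

Let mZ k : (0 < k)%N -> measurable_fun (H k : set (F D)) (Z k).
Proof. exact: measurable_kth_point rA A0 k. Qed.

Variables (alpha eta : R).
Hypothesis a0 : 0 < alpha.
Hypothesis e0 : 0 < eta.

Let pe k : T -> \bar R := (fun w => (expR (- alpha * Z k w))%:E) \_ (H k).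

Let pe_ge0 k w : (0 <= pe k w)%E.
Proof. by rewrite /pe /patch; case: ifP => // _; rewrite lee_fin expR_ge0. Qed.

Let mpe k : (0 < k)%N -> measurable_fun (setT : set (F D)) (pe k).
Proof.
move=> k0; apply/(measurable_restrictT _ (mH k0)); apply/measurable_EFinP.
apply: measurableT_comp; first exact: measurable_expR.
by apply: measurable_funM; [exact: measurable_cst|exact: mZ].
Qed.

Lemma exp_sum_kth w : exp_sum alpha (A w) = (\sum_(k <oo) pe k.+1 w)%E.
Proof.
pose S k := [set z | is_kth_point (A w) k.+1 z].
rewrite /exp_sum (_ : A w = \bigcup_k S k); last first.
  apply/seteqP; split => [z Az|z [k _ [Az _]]]; last by [].
  by have [[//|k] _ kz] := point_is_kth (rA.1 w) (@A0 w) Az; exists k.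
rewrite nneseries_sum_bigcup; last 2 first.
- apply/trivIsetP => k l _ _ kl; rewrite -subset0 => z [kz lz].
  by move/eqP: kl; apply; exact: (succn_inj (is_kth_point_rank kz lz)).
- by move=> x; rewrite lee_fin expR_ge0.
apply: eq_eseriesr => k _; rewrite /pe /patch; case: ifPn => [/set_mem Hk|].
  rewrite (_ : S k = [set Z k.+1 w]) ?esum_set1// ?lee_fin ?expR_ge0//.
  by apply/seteqP; split => [z /ZE//|_ ->]; exact: kth_pointP.
rewrite notin_setE => nH; rewrite (_ : S k = set0) ?esum_set0//.
by rewrite -subset0 => z kz; apply: nH; exists z.
Qed.

Lemma exp_sum_measurable :
  measurable_fun (setT : set (F D)) (fun w => exp_sum alpha (A w)).
Proof.
rewrite (_ : (fun w => _) = (fun w => \sum_(k <oo) pe k.+1 w)%E); last first.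
  by apply/funext => w; exact: exp_sum_kth.
by apply: ge0_emeasurable_sum => [k w _ _|k _]; [exact: pe_ge0|exact: mpe].
Qed.

(* Dominates the exponential sum of the next generation: the barrier at [0] is
   dropped, so that the offspring weights no longer depend on the positions. *)
Definition generation_weight w : \bar R :=
  (\sum_(k <oo) pe k.+1 w * driver_weight alpha eta (iota k.+1) w)%E.

Lemma generation_weight_ge0 w : (0 <= generation_weight w)%E.
Proof. by apply: nneseries_ge0 => k _ _; rewrite mule_ge0// driver_weight_ge0. Qed.

Lemma generation_weight_measurable : measurable_fun setT generation_weight.
Proof.
apply: ge0_emeasurable_sum => [k w _ _|k _].
  by rewrite mule_ge0// driver_weight_ge0.
apply: emeasurable_funM; last by apply: driver_weight_measurable; exact: iotaD0.
by apply: (history_measurable_funT pppd DD0); exact: mpe.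
Qed.

(** Each term is the product of a function of the parent's position, measurable for the past, and
    the weight of a fresh driver, whose mean is the same for all parents. *)
Lemma integral_generation_weight :
  (\int[P]_w generation_weight w =
    \int[P]_w exp_sum alpha (A w) * offspring_exp_bound eta u alpha)%E.
Proof.
rewrite integral_nneseries//; last 2 first.
- move=> k; apply: emeasurable_funM; last by apply: driver_weight_measurable;
  exact: iotaD0.
  by apply: (history_measurable_funT pppd DD0); exact: mpe.
- by move=> k w _; rewrite mule_ge0// driver_weight_ge0.
under eq_eseriesr.
  move=> k _; rewrite (@integral_driver_weight _ _ D)//;
    [|exact: iotaD0|exact: iotaD|exact: mpe].
  over.
transitivity (\sum_(k <oo) offspring_exp_bound eta u alpha * \int[P]_w pe k.+1 w)%E.
  by apply: eq_eseriesr => k _; rewrite muleC.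
rewrite -nneseriesZle; last 2 first.
- apply: nneseries_ge0 => j _ _; by rewrite mule_ge0 ?zeta_intensity_ge0//
  lee_fin expR_ge0.
- by move=> k; exact: integral_ge0.
rewrite muleC -integral_nneseries//; last first.
  by move=> k; apply: (history_measurable_funT pppd DD0); exact: mpe.
by congr (_ * _)%E; apply: eq_integral => w _; rewrite exp_sum_kth.
Qed.

(** Coinciding children count once on the left and once per brood on the right, which is the
    favourable direction. *)
Lemma exp_sum_next_generation_le w : (exp_sum alpha (C w) <= generation_weight w)%E.
Proof.
rewrite /C next_generation_brood.
apply: (le_trans (esum_bigcup_le _ _)) => [x|]; first by rewrite lee_fin expR_ge0.
apply: lee_nneseries => [k _ _|k _].
  by apply: esum_ge0 => x _; rewrite lee_fin expR_ge0.
rewrite /pe /patch; case: ifPn => [/set_mem Hk|]; last first.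
  rewrite notin_setE => nH; rewrite (_ : brood _ _ _ _ _ = set0) ?esum_set0 ?mul0e//.
  by rewrite -subset0 => y [z kz]; case: nH; exists z.
apply: exp_sum_translate_le => // y [z kz [x dx [-> _]]].
by rewrite (ZE kz) addrK.
Qed.
End generation_bounds.

Section generation_lower_bound.
Variables (D : set I) (A : T -> set R) (iota : nat -> I).
Hypothesis DD0 : D `<=` D0.
Hypothesis rA : @random_locally_finite _ (F D) R A.
Hypothesis A0 : forall w, A w `<=` [set x | 0 <= x].
Hypothesis iotaD0 : forall k, (0 < k)%N -> D0 (iota k).
Hypothesis iotaD : forall k, (0 < k)%N -> ~ D (iota k).
Hypothesis iota_inj : forall k l, (0 < k)%N -> (0 < l)%N -> iota k = iota l -> k = l.

Let Z k w := kth_point (A w) k.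
Let H k := has_kth A k.
Let C := next_generation drv A iota.

(** Two scales: the test function lives on cells of length [delta], each cut into [m] fine cells
    that locate the parent. [c l] bounds from below the mean number of children in [a, b) of a
    parent in the coarse cell [l]. *)
Variables (delta : R) (m L : nat) (a b : R) (c : nat -> R).
Hypothesis delta0 : 0 < delta.
Hypothesis m0 : (0 < m)%N.
(* Parents are located up to [eta], so the window for their displacements is
   shortened by [eta]. *)
Let eta := delta / m%:R.
Hypothesis a0 : 0 <= a.
Hypothesis ab : eta <= b - a.
Hypothesis c0 : forall l, 0 <= c l.
Hypothesis cP : forall l t, (l < L)%N -> delta * l%:R <= t -> t + eta <=
  delta * l.+1%:R ->
  ((c l)%:E <= zeta_intensity u `[(a - t)%R, (b - t - eta)%R[)%E.

Let eta0 : 0 < eta. Proof. by rewrite divr_gt0// ltr0n. Qed.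
Let t (l i : nat) : R := delta * l%:R + eta * i%:R.
Let cell l i : set R := `[t l i, (t l i + eta)%R[%classic.
Let Hc k l i : set T := H k `&` Z k @^-1` cell l i.
Let win l i : set R := `[(a - t l i)%R, (b - t l i - eta)%R[%classic.

Let mHc k l i : measurable (Hc k.+1 l i : set (F D)).
Proof.
apply: (measurable_kth_point rA A0 (ltn0Sn k)); last exact: measurable_itv.
exact: measurable_has_kth rA A0 _ (ltn0Sn k).
Qed.

Let tS l i : t l i + eta = t l i.+1.
Proof. by rewrite /t -natr1; ring. Qed.

Let t_ge l i : delta * l%:R <= t l i.
Proof. by rewrite lerDl mulr_ge0// ltW. Qed.

Let t_m l : t l m = delta * l.+1%:R.
Proof.
rewrite /t /eta divfK ?pnatr_eq0 -?lt0n//.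
by rewrite -natr1 mulrDr mulr1.
Qed.

Let t_le l i : (i <= m)%N -> t l i <= delta * l.+1%:R.
Proof. by move=> im; rewrite -t_m lerD2l ler_pM2l// ler_nat. Qed.

Let cell_inj l i l' i' x : (i < m)%N -> (i' < m)%N ->
  cell l i x -> cell l' i' x -> l = l' /\ i = i'.
Proof.
move=> im im'; rewrite /cell /= !in_itv /= !tS => /andP[h1 h2] /andP[h3 h4].
have step (l1 l2 i1 i2 : nat) : (i1 < m)%N -> (i2 < m)%N -> t l1 i1 <= x ->
  x < t l2 i2.+1 -> (l1 <= l2)%N.
  move=> i1m i2m h h'; have := le_lt_trans (le_trans (t_ge l1 i1) h) (lt_le_trans
    h' (t_le l2 i2m)).
  by rewrite ltr_pM2l// ltr_nat ltnS.
have ll' : l = l' by apply/eqP; rewrite eqn_leq (step l l' i i') ?(step l' l i' i).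
split => //; rewrite -ll' in h3 h4.
have := le_lt_trans h1 h4; have := le_lt_trans h3 h2.
by rewrite !ltrD2l !ltr_pM2l// !ltr_nat !ltnS => ? ?; apply/eqP; rewrite eqn_leq;
  apply/andP.
Qed.

Let g k w : \bar R :=
  (\sum_(l < L) \sum_(i < m) (\1_(Hc k l i) w)%:E * npoints (drv (iota k) w) (win
    l i))%E.

(** At most one fine cell contains the parent, so at most one term of [g] survives. A displacement
    in the corresponding window puts the child in [a, b), and [a >= 0] keeps it above the
    barrier. *)
Let g_le k w : (g k w <= counting (brood drv A iota k w `&` `[a, b[))%E.
Proof.
have [[[l i] /= [Hk Zc]]|no] := pselect (exists li : 'I_L * 'I_m,
  Hc k li.1 li.2 w); last first.
  rewrite /g big1 ?counting_ge0// => l _; rewrite big1// => i _.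
  by rewrite indicE memNset ?mul0e// => hw; apply: no; exists (l, i).
rewrite /g (bigD1 l)//= [X in (_ + X)%E]big1 ?adde0; last first.
  move=> l' /eqP ll'; rewrite big1// => i' _.
  rewrite indicE memNset ?mul0e// => -[_ Zc'].
  have [/val_inj ll _] := cell_inj (ltn_ord i') (ltn_ord i) Zc' Zc.
  by apply: ll'.
rewrite (bigD1 i)//= [X in (_ + X)%E]big1 ?adde0; last first.
  move=> i' /eqP ii'; rewrite indicE memNset ?mul0e// => -[_ Zc'].
  have [_ /val_inj ii] := cell_inj (ltn_ord i') (ltn_ord i) Zc' Zc.
  by apply: ii'.
rewrite indicE mem_set ?mul1e; last by split.
apply: (counting_injW (h := fun x => x + Z k w)); first exact: addIr.
move=> x [dx]; move: Zc; rewrite /win /cell /= !in_itv /=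
  => /andP[z1 z2] /andP[x1 x2].
have ax : a <= x + Z k w by lra.
split; last by rewrite ax /=; lra.
exists (Z k w); first exact: kth_pointP.
by exists x => //; split => //; exact: le_trans ax.
Qed.

(** The count of a generation equals the sum of the counts of its broods only when these are
    disjoint, hence off a null set. *)
Lemma next_generation_lower_bound :
  (\sum_(l < L) (c l)%:E * \int[P]_w npoints (A w) `[(delta * l%:R)%R,
    (delta * l.+1%:R)%R[
    <= \int[P]_w npoints (C w) `[a, b[)%E.
Proof.
have mdr k l i : measurable_fun setT (fun w => npoints (drv (iota k.+1) w) (win l i)).
  by apply: (ppp_measurable (pppd (iotaD0 (ltn0Sn k)))); exact: measurable_itv.
have mHcT k l i : measurable (Hc k.+1 l i).
  exact: history_measurable_setT pppd _ _ DD0 (mHc k l i).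
have mJ k (l : nat) : measurable (H k.+1 `&` Z k.+1 @^-1` `[(delta * l%:R)%R,
  (delta * l.+1%:R)%R[).
  apply: (history_measurable_setT pppd DD0).
  apply: (measurable_kth_point rA A0 (ltn0Sn k)); last exact: measurable_itv.
  exact: measurable_has_kth rA A0 _ (ltn0Sn k).
have mterm k l i : measurable_fun setT
    (fun w => (\1_(Hc k.+1 l i) w)%:E * npoints (drv (iota k.+1) w) (win l i))%E.
  by apply: emeasurable_funM => //; apply/measurable_EFinP; exact: measurable_indic.
have term0 k l i w : (0 <= (\1_(Hc k.+1 l i) w)%:E * npoints (drv (iota k.+1) w)
  (win l i))%E.
  by rewrite mule_ge0 ?counting_ge0// lee_fin.
have mg k : measurable_fun setT (g k.+1).
  by apply: emeasurable_sum => l; apply: emeasurable_sum => i.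
have g0 k w : (0 <= g k.+1 w)%E by apply: sume_ge0 => l _; apply: sume_ge0.
apply: (@le_trans _ _ (\int[P]_w \sum_(k <oo) g k.+1 w)%E); last first.
  apply: (ge0_le_integral_off_null_l
    (broods_disjoint u0 pppd indd DD0 rA A0 iotaD0 iotaD iota_inj)).
  - by apply: ge0_emeasurable_sum.
  - by move=> w; exact: nneseries_ge0.
  - by move=> w; exact: counting_ge0.
  move=> w /contrapT tw; rewrite /C next_generation_brood /npoints setI_bigcupl.
  rewrite counting_bigcup; last exact: trivIset_setIr.
  by apply: lee_nneseries => // k _; exact: g_le.
rewrite integral_nneseries//.
apply: (@le_trans _ _ (\sum_(k <oo) \sum_(l < L) \sum_(i < m) (c l)%:E * P (Hc
  k.+1 l i))%E); last first.
  apply: lee_nneseries => [k _ _|k _].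
    by apply: sume_ge0 => l _; apply: sume_ge0 => i _; rewrite mule_ge0 ?lee_fin.
  rewrite ge0_integral_sum//; last 2 first.
  - by move=> l; apply: emeasurable_sum.
  - by move=> l w _; apply: sume_ge0.
  apply: lee_sum => l _; rewrite ge0_integral_sum//.
  apply: lee_sum => i _.
  rewrite (@integral_history_driver _ _ _ _ _ u0 _ _ _ pppd indd D)//; last 4 first.
  - exact: iotaD0.
  - exact: iotaD.
  - by rewrite addrAC lerD2r lerBrDr addrC -lerBrDr.
  - by apply/measurable_EFinP; exact: measurable_indic.
  rewrite integral_indicT// muleC lee_wpmul2l//.
  apply: (cP (ltn_ord l) (t_ge l i)).
  by rewrite tS; exact: t_le (ltn_ord i).
apply: (@le_trans _ _ (\sum_(k <oo) \sum_(l < L) (c l)%:E *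
    P (H k.+1 `&` Z k.+1 @^-1` `[(delta * l%:R)%R, (delta * l.+1%:R)%R[))%E).
  rewrite nneseries_sum; last by move=> l k _; rewrite mule_ge0 ?lee_fin.
  rewrite le_eqVlt; apply/orP; left; apply/eqP; apply: eq_bigr => l _.
  rewrite nneseriesZl//; congr (_ * _)%E.
  under eq_integral do rewrite (npoints_kth rA A0).
  rewrite integral_nneseries//; last first.
    by move=> k; apply/measurable_EFinP; exact: measurable_indic.
  by apply: eq_eseriesr => k _; rewrite integral_indicT.
apply: lee_nneseries => [k _ _|k _].
  by apply: sume_ge0 => l _; rewrite mule_ge0 ?lee_fin.
apply: lee_sum => l _.
rewrite -ge0_sume_distrr//; apply: lee_wpmul2l; first by rewrite lee_fin.
(* The fine cells cover the coarse one, so the union bound gives the direction that is wanted. *)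
apply: (le_trans _ (Boole_inequality _ (fun i _ => mHcT k l i))).
apply: le_measure; rewrite ?inE//.
  by apply: bigsetU_measurable => i _; exact: mHcT.
move=> w [Hk]; rewrite /= in_itv /= => /andP[z1 z2].
rewrite -bigcup_mkord.
have Zl : 0 <= (Z k.+1 w - delta * l%:R) / eta by rewrite divr_ge0 ?subr_ge0// ltW.
have i1 := truncn_le ((Z k.+1 w - delta * l%:R) / eta).
have i2 := truncnS_gt ((Z k.+1 w - delta * l%:R) / eta).
move: (Num.truncn _) i1 i2 => i; rewrite Zl => i1 i2.
move: i1 i2; rewrite ler_pdivlMr// ltr_pdivrMr// => i1 i2.
have h1 : t l i <= Z k.+1 w by rewrite /t; lra.
have h2 : Z k.+1 w < t l i.+1 by rewrite /t; lra.
exists i; last by split => //; rewrite /cell /= in_itv /= h1 tS.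
have := le_lt_trans h1 z2; rewrite -t_m /= ltrD2l ltr_pM2l// ltr_nat.
by [].
Qed.
End generation_lower_bound.
End step_bounds.

(** * Tent functions and constants *)

Section tent.
Context (R : realType).

Definition tent (M l : nat) : nat := minn l (M.*2 - l).

(** Away from its peak at [M] the tent is convex: linear on each slope and zero past the feet.
    Truncated subtraction sends [l - s] to 0 at worst, where the tent vanishes too. *)
Lemma tent_step (M S l s : nat) : (s <= S)%N ->
  (l + S <= M)%N || (M + S <= l)%N ->
  ((tent M l).*2 <= tent M (l + s) + tent M (l - s))%N.
Proof. by rewrite /tent; lia. Qed.

Lemma tent_lip (M l s : nat) :
  (tent M l <= tent M (l + s) + s)%N /\ (tent M l <= tent M (l - s) + s)%N.
Proof. by rewrite /tent; lia. Qed.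

Lemma tent1 (M : nat) : (0 < M)%N -> tent M 1 = 1%N.
Proof. by rewrite /tent; lia. Qed.

Lemma tent_middle (M S l : nat) : ~~ ((l + S <= M)%N || (M + S <= l)%N) ->
  (M - S <= tent M l)%N.
Proof. by rewrite /tent; lia. Qed.

(** The second factor is the mass of the kernel [q ^ |s|] truncated to [|s| <= S]. *)
Lemma geometric_two_sided (q : R) (S : nat) :
  (1 - q) * (1 + 2 * \sum_(0 <= s < S) q ^+ s.+1) = 1 + q - 2 * q ^+ S.+1.
Proof.
elim: S => [|S IH]; first by rewrite big_nil; ring.
rewrite big_nat_recr//=; set Q := \sum_(_ <= _ < _) _ in IH *.
have -> : (1 - q) * (1 + 2 * (Q + q ^+ S.+1)) =
  (1 - q) * (1 + 2 * Q) + 2 * (1 - q) * q ^+ S.+1 by ring.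
by rewrite IH [q ^+ S.+2]exprS; ring.
Qed.

(* Near its two feet the tent is convex; elsewhere it is 1-Lipschitz and so large
   that the loss at the top is negligible. *)
Lemma tent_subharmonic (q w eps : R) (S M l : nat) : 0 <= q -> q <= 1 -> 0 <= w ->
  1 + 2 * eps <= w * (1 + 2 * \sum_(0 <= s < S) q ^+ s.+1) -> 0 <= eps ->
  w * 2 * (S * S)%:R <= eps * (M - S)%:R ->
  (1 + eps) * (tent M l)%:R <= w * ((tent M l)%:R +
    \sum_(0 <= s < S) q ^+ s.+1 * ((tent M (l + s.+1))%:R + (tent M (l - s.+1))%:R)).
Proof.
move=> q0 q1 w0 W e0 HM.
set h := (tent M l)%:R.
have h0 : 0 <= h :> R by rewrite ler0n.
have [c|c] := boolP ((l + S <= M)%N || (M + S <= l)%N).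
  apply: (@le_trans _ _ (w * (1 + 2 * \sum_(0 <= s < S) q ^+ s.+1) * h)).
    by rewrite ler_wpM2r//; lra.
  rewrite -mulrA; apply: ler_wpM2l => //.
  rewrite mulrDl mul1r lerD2l mulrAC mulr_sumr big_nat [leRHS]big_nat.
  apply: ler_sum => s /andP[_ sS]; rewrite mulrC ler_wpM2l ?exprn_ge0//.
  by rewrite -natrD -natrM ler_nat mul2n; exact: (@tent_step _ S).
have hM : (M - S)%:R <= h by rewrite ler_nat; exact: tent_middle.
(* Each of the [S] steps loses at most [2 * S], in total the [2 * (S * S)] of the last
   hypothesis. *)
apply: (@le_trans _ _ (w * (h + \sum_(0 <=
  s < S) (q ^+ s.+1 * (2 * h) - 2 * S%:R)))); last first.
  apply: ler_wpM2l => //; rewrite lerD2l big_nat [leRHS]big_nat.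
  apply: ler_sum => s /andP[_ sS].
  have [t1 t2] := tent_lip M l s.+1.
  have sS' : s.+1%:R <= S%:R :> R by rewrite ler_nat.
  have qs0 : 0 <= q ^+ s.+1 by exact: exprn_ge0.
  have qs1 : q ^+ s.+1 <= 1 by exact: exprn_ile1.
  move: t1 t2; rewrite -!(ler_nat R) !natrD -/h => t1 t2.
  apply: (@le_trans _ _ (q ^+ s.+1 * (2 * h - 2 * S%:R))).
    by rewrite mulrBr lerD2l lerN2 -[leRHS]mul1r ler_wpM2r// mulr_ge0.
  by apply: ler_wpM2l => //; lra.
rewrite sumrB -mulr_suml sumr_const_nat subn0.
have -> : 2 * S%:R *+ S = 2 * (S * S)%:R :> R by rewrite -mulr_natr natrM mulrA.
set Q := \sum_(_ <= _ < _) _ in W *.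
have : eps * (M - S)%:R <= eps * h by rewrite ler_wpM2l.
have : (1 + 2 * eps) * h <= w * (1 + 2 * Q) * h by rewrite ler_wpM2r.
lra.
Qed.

(** The exponent [l - j + (j - l)] is the distance of [l] and [j]. Steps below 0 are truncated to 0,
    where the tent vanishes, so they add nothing on the left. *)
Lemma tent_sum_ge (q : R) (S M l : nat) : 0 <= q ->
  (tent M l)%:R + \sum_(0 <= s < S) q ^+ s.+1 *
    ((tent M (l + s.+1))%:R + (tent M (l - s.+1))%:R) <=
  \sum_(0 <= j < M.*2) q ^+ (l - j + (j - l)) * (tent M j)%:R :> R.
Proof.
move=> q0; set G := fun j => q ^+ (l - j + (j - l)) * (tent M j)%:R.
have G0 j : 0 <= G j by rewrite mulr_ge0// ?exprn_ge0// ler0n.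
have tent0 j : (M.*2 <= j)%N -> tent M j = 0%N by rewrite /tent; lia.
pose N := (M.*2 + (l.+1 + S))%N.
have -> : \sum_(0 <= j < M.*2) G j = \sum_(0 <= j < N) G j.
  rewrite (big_cat_nat _ (n := M.*2) (p := N))//=; last by rewrite leq_addr.
  rewrite [X in _ = _ + X]big_nat [X in _ = _ + X]big1 ?addr0// => j /andP[Mj _].
  by rewrite /G tent0// mulr0.
apply: (@le_trans _ _ (\sum_(0 <= j < l.+1 + S) G j)); last first.
  rewrite [leRHS](big_cat_nat _ (n := (l.+1 + S)%N))//=; last by rewrite leq_addl.
  by rewrite lerDl sumr_ge0.
rewrite [leRHS](big_cat_nat _ (n := l.+1))//=; last by rewrite leq_addr.
rewrite big_nat_recr//= [G l]/G subnn addn0 expr0 mul1r.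
rewrite addrAC addrC lerD2l.
under eq_bigr do rewrite mulrDr.
rewrite big_split /= addrC; apply: lerD.
  rewrite [leRHS]big_nat_rev /= add0n.
  have [Sl|lS] := leqP S l.
    rewrite (big_cat_nat _ (n := S) (p := l))//= -[leLHS]addr0; apply: lerD;
      last exact: sumr_ge0.
    rewrite le_eqVlt; apply/orP; left; apply/eqP.
    rewrite big_nat [RHS]big_nat; apply: eq_bigr => s /andP[_ sS].
    by rewrite /G; congr (q ^+ _ * _); lia.
  rewrite (big_cat_nat _ (n := l) (p := S))//=; last exact: ltnW.
  rewrite [X in _ + X]big_nat [X in _ + X]big1 ?addr0; last first.
    move=> s /andP[ls _]; rewrite (_ : (l - s.+1 = 0)%N); last by lia.
    by rewrite /tent min0n mulr0.
  rewrite le_eqVlt; apply/orP; left; apply/eqP.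
  rewrite big_nat [RHS]big_nat; apply: eq_bigr => s /andP[_ sl].
  by rewrite /G; congr (q ^+ _ * _); lia.
rewrite -{1}[l.+1]add0n [leRHS]big_addn addnC addnK.
rewrite le_eqVlt; apply/orP; left; apply/eqP; apply: eq_bigr => s _.
have -> : (s + l.+1 = l + s.+1)%N by lia.
by rewrite /G; congr (q ^+ _ * _); lia.
Qed.

End tent.

Section constants.
Context (R : realType).

Lemma expR_inv_gap (x : R) : 0 < x -> (1 - expR (- x))^-1 <= (1 + x) / x.
Proof.
move=> x0; have ex : 0 < 1 + x by lra.
have : expR (- x) <= (1 + x)^-1.
  by rewrite expRN lef_pV2 ?posrE ?expR_gt0// expR_ge1Dx.
move=> h; rewrite -[leRHS]invrK lef_pV2 ?posrE.
- rewrite invf_div; have -> : x / (1 + x) = 1 - (1 + x)^-1 by field; rewrite gt_eqF.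
  lra.
- by rewrite subr_gt0 expR_lt1 oppr_lt0.
- by rewrite invf_div divr_gt0.
Qed.

(* With [alpha = 2 * u], the ideal value [u / (alpha * (1 - alpha))] is
   [1 / (2 * (1 - 2 * u))]; the cell length [(1 - 4 * u) / 8] costs little. *)
Lemma subcritical_bound (u : R) : 0 < u -> u < 1 / 4 ->
  exists2 eta : R, 0 < eta &
    (offspring_exp_bound eta u (2 * u) <= (1 - (1 - 4 * u) / 4)%:E)%E.
Proof.
move=> u0 u4; set t := 1 - 4 * u; have t0 : 0 < t by rewrite /t; lra.
have t1 : t < 1 by rewrite /t; lra.
have uE : u = (1 - t) / 4 by rewrite /t; field.
pose eta := t / 8; have e0 : 0 < eta by rewrite /eta; lra.
exists eta => //.
apply: (le_trans (offspring_exp_bound_le e0 u0 _ _)); [lra|lra|rewrite lee_fin].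
set al := 2 * u; have al0 : 0 < al by rewrite /al; lra.
have al1 : 0 < 1 - al by rewrite /al; lra.
have ale : al * eta < 1 by rewrite /al /eta; nra.
have h1 := expR_inv_gap (mulr_gt0 al0 e0).
have h2 := expR_inv_gap (mulr_gt0 al1 e0).
have h3 : expR (al * eta) <= (1 - al * eta)^-1.
  rewrite -[al * eta in leLHS]opprK expRN lef_pV2 ?posrE ?expR_gt0 ?subr_gt0//.
  exact: expR_ge1Dx.
apply: (@le_trans _ _ (u * eta * ((1 + al * eta) / (al * eta) +
    (1 - al * eta)^-1 * ((1 + (1 - al) * eta) / ((1 - al) * eta))))).
  apply: ler_wpM2l; first by rewrite mulr_ge0// ltW.
  apply: lerD => //; apply: ler_pM => //.
  by rewrite invr_ge0 subr_ge0 expR_le1 oppr_le0 mulr_ge0// ltW.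
(* The choice [al = 2 * u] turns [u / al] into [1 / 2]. *)
have -> : u * eta * ((1 + al * eta) / (al * eta) +
    (1 - al * eta)^-1 * ((1 + (1 - al) * eta) / ((1 - al) * eta))) =
  (1 + al * eta) / 2 + u * (1 + (1 - al) * eta) / ((1 - al * eta) * (1 - al)).
  clear h1 h2 h3; move: al1 ale; rewrite /al => al1 ale; field.
  by rewrite (gt_eqF al1) (gt_eqF e0) (gt_eqF u0) gt_eqF// subr_gt0.
rewrite -lerBrDl ler_pdivrMr; last by rewrite mulr_gt0// subr_gt0.
(* What remains is a polynomial inequality in [t] on (0, 1). *)
rewrite /al /eta uE; nra.
Qed.

(** Lattice form of the conjugation identity (x - y)^+ = (x - y) / 2 + |x - y| / 2. Rounding the
    parent up to [l.+1] costs at most the extra [- delta]. *)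
Lemma exponent_compare (delta : R) (l j : nat) : 0 <= delta ->
  - (delta * l%:R / 2) - delta + (l - j + (j - l))%:R * - (delta / 2) <=
  - (delta * (l.+1 - j)%:R) - delta * j%:R / 2.
Proof.
move=> d0; have [jl|lj] := leqP j l.
  rewrite (eqP jl) addn0 natrB// natrB ?leqW// -[l.+1%:R]natr1; lra.
rewrite (eqP (ltnW lj)) (eqP lj) add0n natrB; last exact: ltnW.
lra.
Qed.

(* The summand bounds from below the mean number of children in the [j]-th cell of
   a particle of the [l]-th cell, times the test function at [j]. *)
Lemma supercritical_constants (u r : R) : 1 / 4 < u -> 0 < r ->
  exists (delta : R) (m M : nat), [/\ 0 < delta, delta <= r, (1 < m)%N, (0 < M)%N &
    exists2 eps : R, 0 < eps & forall l : nat,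
      (1 + eps) * (expR (- (delta * l%:R / 2)) * (tent M l)%:R) <=
      \sum_(0 <= j < M.*2) u * (delta - delta / m%:R) * expR (- (delta * (l.+1 -
        j)%:R)) *
         (expR (- (delta * j%:R / 2)) * (tent M j)%:R)].
Proof.
move=> u4 r0.
(* Chosen so that 4 * u * (1 - 3 * delta) is still at least 2 * u + 1 / 2, which is 1 + 2 * eps for
   the [eps] below. *)
pose delta := Num.min r ((1 - 1 / (4 * u)) / 6).
have u0 : 0 < u by lra.
have k0 : 0 < 1 - 1 / (4 * u) by rewrite subr_gt0 ltr_pdivrMr; lra.
have d0 : 0 < delta by rewrite lt_min r0 /=; lra.
have dr : delta <= r by rewrite ge_min lexx.
have dk : delta <= (1 - 1 / (4 * u)) / 6 by rewrite ge_min lexx orbT.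
have d1 : delta <= 1 / 6.
  have : 0 < 1 / (4 * u) by rewrite divr_gt0; lra.
  lra.
have ud : 2 * u + 1 / 2 <= 4 * u * (1 - 3 * delta).
  have : 4 * u * delta <= 4 * u * ((1 - 1 / (4 * u)) / 6) by rewrite ler_pM2l//; lra.
  have -> : 4 * u * ((1 - 1 / (4 * u)) / 6) = (4 * u - 1) / 6 by field; lra.
  lra.
(* Makes both [1 < m] and [1 / m <= delta], so that locating the parent loses at most a factor
   [1 - delta]. *)
pose m := (Num.truncn (1 / delta)).+2.
have md : m%:R^-1 <= delta.
  rewrite -[leRHS]invrK lef_pV2 ?posrE ?invr_gt0//.
  rewrite -div1r; apply: ltW; apply: lt_le_trans (truncnS_gt _) _.
  by rewrite ler_nat.
pose q := expR (- (delta / 2)).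
pose w := u * (delta - delta / m%:R) * expR (- delta).
(* Large enough for the truncated tail to satisfy [q ^+ S.+1 <= delta / 4]. *)
pose S := (Num.truncn (8 / delta ^+ 2)).+1.
pose eps := u - 1 / 4.
have q0 : 0 < q by exact: expR_gt0.
have q1 : q < 1 by rewrite expR_lt1 oppr_lt0 divr_gt0.
have m1 : m%:R^-1 < 1 :> R by rewrite invf_lt1 ?ltr1n// ltr0n.
have w0 : 0 <= w.
  by rewrite !mulr_ge0 ?expR_ge0// ?(ltW u0)// subr_ge0 ler_piMr// ltW.
have W : 1 + 2 * eps <= w * (1 + 2 * \sum_(0 <= s < S) q ^+ s.+1).
  set Y := (1 + 2 * \sum_(_ <= _ < _) _); have Y1 : 1 <= Y.
    by rewrite lerDl mulr_ge0// sumr_ge0// => s _; rewrite exprn_ge0// ltW.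
  have YE : (1 - q) * Y = 1 + q - 2 * q ^+ S.+1 by exact: geometric_two_sided.
  have q2 : 1 - delta / 2 <= q by exact: expR_ge1Dx.
  have qS : q ^+ S.+1 <= delta / 4.
    have S8 : 8 / delta ^+ 2 < S%:R by exact: truncnS_gt.
    rewrite ltr_pdivrMr ?exprn_gt0// in S8.
    have SS : S%:R <= S.+1%:R :> R by rewrite ler_nat.
    have x0 : 0 < S.+1%:R * (delta / 2) by rewrite mulr_gt0 ?ltr0n ?divr_gt0.
    rewrite /q -expRM_natl mulrN expRN.
    rewrite -[leRHS]invrK lef_pV2 ?posrE ?expR_gt0 ?invr_gt0 ?divr_gt0//.
    apply: le_trans (expR_ge1Dx _).
    rewrite invf_div ler_pdivrMr//; move: S8; rewrite expr2; nra.
  (* As [1 - q <= delta / 2], the closed form [YE] gives (delta / 2) * Y >= 2 - delta. This is the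
     lattice version of the total mass 4 of exp (- |x| / 2). *)
  have dY : 2 * (2 - delta) <= delta * Y by nra.
  have e1 : 1 - delta <= expR (- delta) by exact: expR_ge1Dx.
  have wE : w * Y = u * (1 - m%:R^-1) * expR (- delta) * (delta * Y) by rewrite /w;
    ring.
  rewrite wE; apply: (@le_trans _ _ (u * (1 - delta) * (1 - delta) * (2 * (2 -
    delta)))).
    have : 4 * u * (1 - 3 * delta) <= u * (1 - delta) * (1 - delta) * (2 * (2 -
      delta)).
      rewrite -!mulrA [4 * _]mulrCA ler_pM2l//; nra.
    by rewrite /eps; lra.
  apply: ler_pM => //; [|lra|].
    by rewrite !mulr_ge0//; lra.
  apply: ler_pM => //; [|lra|].
    by rewrite mulr_ge0//; lra.
  by rewrite ler_pM2l//; lra.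
(* The half-width is taken so large that the loss at the peak is at most [eps * (M - S)]. *)
pose M := (S + (Num.truncn (w * 2 * (S * S)%:R / eps)).+1)%N.
have e0 : 0 < eps by rewrite /eps; lra.
exists delta, m, M; split => //.
exists eps => // l.
apply: (@le_trans _ _ (expR (- (delta * l%:R / 2)) * (w * ((tent M l)%:R +
    \sum_(0 <= s < S) q ^+ s.+1 * ((tent M (l + s.+1))%:R + (tent M (l -
      s.+1))%:R))))).
  rewrite mulrCA ler_wpM2l ?expR_ge0//; apply: tent_subharmonic => //; try exact: ltW.
  rewrite -ler_pdivrMl// mulrC /M addKn ltW// truncnS_gt//.
apply: (@le_trans _ _ (expR (- (delta * l%:R / 2)) *
    (w * \sum_(0 <= j < M.*2) q ^+ (l - j + (j - l)) * (tent M j)%:R))).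
  rewrite ler_wpM2l ?expR_ge0// ler_wpM2l//; apply: tent_sum_ge; exact: ltW.
rewrite !mulr_sumr; apply: ler_sum => j _.
rewrite !mulrA ler_wpM2r ?ler0n// /w.
rewrite /q -expRM_natl -[leRHS]mulrA.
set K := u * _; set E1 := expR _; set E3 := expR (_ * _).
have -> : E1 * u * (delta - delta / m%:R) * expR (- delta) * E3 =
  K * (E1 * expR (- delta) * E3) by rewrite /K; ring.
apply: ler_wpM2l; first by rewrite mulr_ge0 ?(ltW u0)// subr_ge0 ler_piMr// ltW.
rewrite -!expRD ler_expR.
exact/exponent_compare/ltW.
Qed.
End constants.

(** * The particle process *)

Section process.
Context d (T : measurableType d) (R : realType) (P : probability T R) (u : R).
Hypothesis u0 : 0 < u.
Variables (xi0 : T -> set R) (xi : nat -> nat -> T -> set R).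
Hypothesis iid : iid_poisson_family P u xi0 xi.

Local Notation drv := (driving_family xi0 xi).
Local Notation D0 := driving_index.
Local Notation F D := (g_sigma_algebraType (history drv D)).

Let pppd : forall i, D0 i -> poisson_point_process P (zeta_intensity u) (drv i) :=
  iid.1.
Let indd : mutually_independent P D0 (fun i => sigma_point_process (drv i)) := iid.2.

(** The drivers that determine generation [n]: [xi0] and the rows 1 to n - 1. In particular
    [clipped n], which is generation [n.+1], depends on [past n.+1]. *)
Let past (n : nat) : set (option (nat * nat)) :=
  [set i | if i is Some (k, m) then (0 < k)%N /\ (0 < m < n)%N else True].

Let iota (n k : nat) : option (nat * nat) := Some (k, n).

(* Generation [n.+1], made empty as soon as it is not locally finite. *)
Fixpoint clipped (n : nat) (w : T) : set R :=
  if n is n'.+1 then clip (next_generation drv (clipped n') (iota n) w)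
  else xi0 w `&` [set x | 0 <= x].

Let pastD0 n : past n `<=` D0.
Proof. by move=> [[k m]|//] /= [? /andP[]]. Qed.

Let iotaD0 n k : (0 < k)%N -> D0 (iota n.+1 k).
Proof. by []. Qed.

Let iota_past n k : (0 < k)%N -> ~ past n.+1 (iota n.+1 k).
Proof. by move=> _ [_ /andP[_]]; rewrite ltnn. Qed.

Let iota_inj n k l : (0 < k)%N -> (0 < l)%N -> iota n.+1 k = iota n.+1 l -> k = l.
Proof. by move=> _ _ []. Qed.

Let pastS n : past n.+1 `|` iota n.+1 @` [set k | (0 < k)%N] `<=` past n.+2.
Proof.
move=> [[k m]|//] /= [[k0 /andP[m0 mn]]|[k' k'0 [<- <-]]]; last by rewrite ltnSn.
by rewrite k0 m0 ltnW.
Qed.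

Lemma clipped_ge0 n w : clipped n w `<=` [set x | 0 <= x].
Proof.
case: n => [x []//|n] x /= [Cx _]; exact: next_generation_ge0 Cx.
Qed.

Lemma clipped_random n : @random_locally_finite _ (F (past n.+1)) R (clipped n).
Proof.
elim: n => [|n IH].
  have r0 : @random_locally_finite _ (F (past 1)) R xi0.
    exact: (@driver_random _ _ _ _ _ _ _ _ pppd (past 1) None).
  split => [w a b|B mB].
    by apply: sub_finite_set (r0.1 w a b) => x [[]].
  have := r0.2 (B `&` `[0, +oo[%classic) (measurableI _ _ mB (measurable_itv _)).
  congr (measurable_fun _ _); apply/funext => w; congr counting.
  apply/seteqP; split => x /=; rewrite in_itv /= andbT.
    by move=> [? []].
  by move=> [[]].
apply: (random_subset (@pastS n)).
apply: (next_generation_clip_random pppd IH (@clipped_ge0 n)) => k k0.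
exact: iotaD0.
Qed.

Let mclipped n B : measurable B -> measurable_fun setT (fun w =>
  npoints (clipped n w) B).
Proof.
move=> mB; apply: (history_measurable_funT pppd (@pastD0 n.+1)).
exact: (clipped_random n).2.
Qed.

Let mexp alpha n : measurable_fun setT (fun w => exp_sum alpha (clipped n w)).
Proof.
apply: (history_measurable_funT pppd (@pastD0 n.+1)).
exact: exp_sum_measurable (clipped_random n) (@clipped_ge0 n) alpha.
Qed.

Section exponential_moment.
Variables (alpha eta : R).
Hypothesis a0 : 0 < alpha.
Hypothesis e0 : 0 < eta.
Let lambda := offspring_exp_bound eta u alpha.

Lemma integral_exp_sum_clippedS n :
  (\int[P]_w exp_sum alpha (clipped n.+1 w) <=
    \int[P]_w exp_sum alpha (clipped n w) * lambda)%E.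
Proof.
rewrite -(integral_generation_weight u0 pppd indd (@pastD0 n.+1) (clipped_random n)
  (@clipped_ge0 n) (iotaD0 n) (@iota_past n) alpha e0).
apply: ge0_le_integralT => w; first exact: exp_sum_ge0.
apply: (@le_trans _ _ (exp_sum alpha (next_generation drv (clipped n) (iota n.+1)
  w))).
  by apply: le_esum_subset => [x []//|x]; rewrite lee_fin expR_ge0.
exact: (exp_sum_next_generation_le (iota n.+1) (clipped_random n) (@clipped_ge0
  n) a0 e0).
Qed.

(** Generation 1 is treated as the brood of a parent at 0, with an empty past. *)
Lemma integral_exp_sum_clipped0 :
  (\int[P]_w exp_sum alpha (clipped 0 w) <= lambda)%E.
Proof.
apply: (@le_trans _ _ (\int[P]_w (cst 1 w * driver_weight drv alpha eta None w))%E).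
  apply: ge0_le_integralT => w; first exact: exp_sum_ge0.
  have := @exp_sum_translate_le _ alpha eta 0 (xi0 w) (clipped 0 w) a0 e0.
  rewrite mulr0 expR0 /=; apply => x [xx _]; by rewrite subr0.
rewrite (@integral_driver_weight _ _ _ _ _ u0 _ _ _ pppd indd _ _ set0)//.
have -> : (\int[P]_w cst 1%E w = 1)%E.
  by rewrite integral_cst// mul1e; exact: probability_setT.
by rewrite mul1e.
Qed.

Lemma integral_exp_sum_clipped (c : R) n : 0 <= c -> (lambda <= c%:E)%E ->
  (\int[P]_w exp_sum alpha (clipped n w) <= (c ^+ n.+1)%:E)%E.
Proof.
move=> c0 lc; elim: n => [|n IH].
  by rewrite expr1; exact: le_trans integral_exp_sum_clipped0 lc.
apply: (le_trans (integral_exp_sum_clippedS n)).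
rewrite exprSr EFinM; apply: lee_pmul => //.
  by apply: integral_ge0 => w _; exact: exp_sum_ge0.
exact: offspring_exp_bound_ge0.
Qed.

(** The dominating weight [V] has finite mean, hence is almost surely finite, and it bounds the
    number of points in every [0, b]. *)
Lemma next_generation_locally_finite_lty n : (lambda < +oo)%E ->
  P.-negligible [set w | ~ locally_finite (next_generation drv (clipped n) (iota
    n.+1) w)].
Proof.
move=> loo.
pose V := generation_weight drv (clipped n) (iota n.+1) alpha eta.
have V0 w : (0 <= V w)%E by exact: generation_weight_ge0.
have mV : measurable_fun setT V.
  exact: (generation_weight_measurable pppd (@pastD0 n.+1) (clipped_random n)
    (@clipped_ge0 n) (iotaD0 n)).
have l0 : (0 <= lambda)%E by exact: offspring_exp_bound_ge0.
have lfin : lambda \is a fin_num by rewrite ge0_fin_numE.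
have iV : P.-integrable setT V.
  apply/integrableP; split => //.
  rewrite (eq_integral V); last by move=> w _; rewrite gee0_abs.
  rewrite /V (integral_generation_weight u0 pppd indd (@pastD0 n.+1)
    (clipped_random n)
    (@clipped_ge0 n) (iotaD0 n) (@iota_past n) alpha e0).
  rewrite -/lambda -(fineK lfin).
  apply: (@le_lt_trans _ _ (((fine lambda) ^+ n.+1)%:E * (fine lambda)%:E)%E).
    rewrite lee_wpmul2r ?lee_fin ?fine_ge0//; apply: integral_exp_sum_clipped.
      exact: fine_ge0.
    by rewrite fineK.
  by rewrite -EFinM ltry.
have [N [mN N0 subN]] := integrable_ae measurableT iV.
exists N; split => // w nlf; apply: subN => /= /(_ I) Vfin; apply: nlf => a b.
set C := next_generation _ _ _ w.
have Cb : (npoints C `[0%R, b] < +oo)%E.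
  apply: (le_lt_trans (npoints_le_exp_sum b C (ltW a0))).
  apply: (@le_lt_trans _ _ ((expR (alpha * b))%:E * V w)%E).
    rewrite lee_wpmul2l ?lee_fin ?expR_ge0//.
    exact: (exp_sum_next_generation_le (iota n.+1) (clipped_random n)
      (@clipped_ge0 n) a0 e0).
  by rewrite -(fineK Vfin) -EFinM ltry.
apply: sub_finite_set (counting_lty Cb) => x [Cx];
  rewrite /= !in_itv /= => /andP[_ xb].
by split => //; rewrite xb andbT; exact: next_generation_ge0 Cx.
Qed.
End exponential_moment.

Lemma next_generation_locally_finite n : P.-negligible
  [set w | ~ locally_finite (next_generation drv (clipped n) (iota n.+1) w)].
Proof.
have half0 : 0 < 1 / 2 :> R by lra.
(* For local finiteness the bound need only be finite, not below 1; any exponent in (0, 1) and any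
   mesh achieve this for every [u]. *)
apply: (@next_generation_locally_finite_lty (1 / 2) 1) => //.
by apply: (le_lt_trans (offspring_exp_bound_le _ u0 _ _)) => //; [lra|rewrite ltry].
Qed.

(** By induction, discarding one more null set per generation, on which clipping would change
    something. *)
Lemma clipped_zeta n :
  P.-negligible [set w | zeta (xi0 w) (fun k m => xi k m w) n.+1 <> clipped n w].
Proof.
elim: n => [|n IH].
  rewrite (_ : mkset _ = set0); first exact: negligible_set0.
  by rewrite -subset0 => w /=; apply.
have lf := next_generation_locally_finite n.
apply: negligibleS (negligibleU IH lf) => w /= ne.
have [lfw|] := pselect (locally_finite (next_generation drv (clipped n) (iota
  n.+1) w)); last by right.
by left => zE; apply: ne; rewrite clip_id// /next_generation -zE.
Qed.

Lemma X_clipped_le (alpha r : R) n : 0 < alpha ->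
  (\int[P]_w X xi0 xi n.+1 0%R r w <=
    (expR (alpha * r))%:E * \int[P]_w exp_sum alpha (clipped n w))%E.
Proof.
move=> a0.
rewrite -ge0_integralZl//; last by move=> w _; exact: exp_sum_ge0.
apply: (ge0_le_integral_off_null_r (clipped_zeta n)).
- by apply: emeasurable_funM.
- by move=> w; exact: counting_ge0.
- by move=> w; rewrite mule_ge0 ?exp_sum_ge0// lee_fin expR_ge0.
by move=> w /contrapT zE; rewrite /X zE; apply: npoints_le_exp_sum; exact: ltW.
Qed.

Lemma X_clipped_ge (r : R) n B : measurable B -> B `<=` `[0, r] ->
  (\int[P]_w npoints (clipped n w) B <= \int[P]_w X xi0 xi n.+1 0%R r w)%E.
Proof.
move=> mB Br; apply: (ge0_le_integral_off_null_l (clipped_zeta n)).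
- exact: mclipped.
- by move=> w; exact: counting_ge0.
- by move=> w; exact: counting_ge0.
by move=> w /contrapT zE; rewrite /X zE; apply: le_counting; exact: setIS.
Qed.

Lemma clippedS_ge (delta : R) (m L : nat) (a b : R) (c : nat -> R) n :
  0 < delta -> (0 < m)%N -> 0 <= a -> delta / m%:R <= b - a -> (forall l, 0 <= c l) ->
  (forall l t, (l < L)%N -> delta * l%:R <= t -> t + delta / m%:R <=
    delta * l.+1%:R ->
    ((c l)%:E <= zeta_intensity u `[(a - t)%R, (b - t - delta / m%:R)%R[)%E) ->
  (\sum_(l < L) (c l)%:E *
      \int[P]_w npoints (clipped n w) `[(delta * l%:R)%R, (delta * l.+1%:R)%R[
    <= \int[P]_w npoints (clipped n.+1 w) `[a, b[)%E.
Proof.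
move=> d0 m0 a0 ab c0 cP.
apply: (le_trans (next_generation_lower_bound u0 pppd indd (@pastD0 n.+1)
  (clipped_random n) (@clipped_ge0 n) (iotaD0 n) (@iota_past n) (@iota_inj n)
  d0 m0 a0 ab c0 cP)).
have lf := next_generation_locally_finite n.
apply: (ge0_le_integral_off_null_l lf).
- apply: (history_measurable_funT pppd (D := past n.+2)) => //.
  apply: (history_measurable_fun (@pastS n)) => //.
  apply: (next_generation_measurable pppd (clipped_random n) (@clipped_ge0 n)) => //.
- by move=> w; exact: counting_ge0.
- by move=> w; exact: counting_ge0.
by move=> w /contrapT lfw; rewrite /= clip_id.
Qed.

Lemma clipped0_cell (a b : R) : 0 <= a -> a <= b ->
  (\int[P]_w npoints (clipped 0 w) `[a, b[ = zeta_intensity u `[a, b[)%E.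
Proof.
move=> a0 ab; rewrite -(@ppp_mean _ _ _ _ _ u0 _ (pppd (i := None) I) _ _ ab).
apply: eq_integral => w _; congr counting; apply/seteqP; split => x /=;
  rewrite in_itv /=.
  by move=> [[]].
by move=> [? /andP[ax xb]]; split; [split => //; exact: le_trans ax|rewrite ax].
Qed.

(** The pairing [S n] of the mean counts with the conjugated tent [f] grows by [1 + eps] per
    generation. One more step collects it in the cell [0, delta), which lies in [0, r]; since
    [clipped n] is generation [n.+1], the result concerns generation [n.+2]. *)
Lemma supercritical_growth (r : R) : 1 / 4 < u -> 0 < r ->
  exists K eps : R, [/\ 0 < K, 0 < eps &
    forall n, ((K * (1 + eps) ^+ n)%:E <= \int[P]_w X xi0 xi n.+2 0%R r w)%E].
Proof.
move=> u4 r0.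
have [delta [m [M [d0 dr m1 M0 [eps e0 tentP]]]]] := supercritical_constants u4 r0.
pose eta := delta / m%:R.
have m0 : (0 < m)%N by exact: ltnW.
have eta_d : eta < delta.
  by rewrite /eta ltr_pdivrMr ?ltr0n// ltr_pMr// ltr1n.
have eta0 : 0 < eta by rewrite divr_gt0// ltr0n.
pose L := M.*2.
pose c j l := u * (delta - eta) * expR (- (delta * (l.+1 - j)%:R)).
pose f l : R := expR (- (delta * l%:R / 2)) * (tent M l)%:R.
pose g n l := (\int[P]_w npoints (clipped n w) `[(delta * l%:R)%R,
  (delta * l.+1%:R)%R[)%E.
have c0 j l : 0 <= c j l.
  by rewrite mulr_ge0 ?expR_ge0// mulr_ge0 ?(ltW u0)// subr_ge0 ltW.
have f0 l : 0 <= f l by rewrite mulr_ge0 ?expR_ge0// ler0n.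
have g0 n l : (0 <= g n l)%E by apply: integral_ge0 => w _; exact: counting_ge0.
have step n j : (\sum_(l < L) (c j l)%:E * g n l <= g n.+1 j)%E.
  apply: (clippedS_ge (m := m)) => //.
  - by rewrite mulr_ge0// ltW.
  - by rewrite -mulrBr -natrB// subSnn mulr1 ltW.
  move=> l t lL lt tl; rewrite -/eta in tl *.
  have -> : c j l = u * expR (- (delta * (l.+1 - j)%:R)) *
      ((delta * j.+1%:R - t - eta) - (delta * j%:R - t)).
    by rewrite /c -[j.+1%:R]natr1; ring.
  apply: zeta_intensity_ge => //; first by rewrite -[j.+1%:R]natr1; lra.
  (* A displacement in the window is at least delta * j - delta * l.+1; truncated subtraction in
     [l.+1 - j] accounts for the minimum with 0. *)
  move=> x /andP[jx _]; rewrite ler_expR le_min; apply/andP; split.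
    by rewrite oppr_le0 mulr_ge0// ltW.
  have [jl|lj] := leqP j l.+1.
    by rewrite natrB//; lra.
  rewrite (eqP (ltnW lj)) mulr0 oppr0.
  have : delta * l.+1%:R <= delta * j%:R by rewrite ler_pM2l// ler_nat ltnW.
  lra.
pose S n := (\sum_(l < L) (f l)%:E * g n l)%E.
have SS n : ((1 + eps)%:E * S n <= S n.+1)%E.
  apply: (@le_trans _ _ (\sum_(j < L) (f j)%:E * \sum_(l < L) (c j l)%:E * g n
    l)%E); last first.
    by apply: lee_sum => j _; rewrite lee_wpmul2l ?lee_fin.
  (* Exchanging the sums lets the mean kernel act on the test function, where [tentP] applies. *)
  have -> : (\sum_(j < L) (f j)%:E * \sum_(l < L) (c j l)%:E * g n l =
      \sum_(l < L) (\sum_(j < L) c j l * f j)%:E * g n l)%E.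
    transitivity (\sum_(j < L) \sum_(l < L) (f j)%:E * ((c j l)%:E * g n l))%E.
      apply: eq_bigr => j _; rewrite ge0_sume_distrr// => l _.
      by rewrite mule_ge0 ?lee_fin.
    rewrite exchange_big /=; apply: eq_bigr => l _.
    rewrite -sumEFin ge0_sume_distrl; last first.
      by move=> j _; rewrite lee_fin mulr_ge0.
    by apply: eq_bigr => j _; rewrite muleA EFinM [X in (X * _)%E]muleC.
  rewrite /S ge0_sume_distrr; last by move=> l _; rewrite mule_ge0 ?lee_fin.
  apply: lee_sum => l _; rewrite muleA -EFinM lee_wpmul2r// lee_fin.
  by have := tentP l; rewrite big_mkord.
have L1 : (1 < L)%N by rewrite /L -[1%N]/(0.*2.+1) ltn_Sdouble.
(* The tent vanishes on cell 0, so the start is taken from cell 1, where generation 1 has mean count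
   [u * delta]. *)
pose k0 := f 1%N * (u * delta).
have k00 : 0 < k0.
  by rewrite /k0 /f tent1// mulr1 mulr_gt0 ?expR_gt0// mulr_gt0.
have S0 : (k0%:E <= S 0%N)%E.
  rewrite /S (bigD1 (Ordinal L1))//= /k0 EFinM.
  rewrite -[leLHS]adde0; apply: leeD; last first.
    by apply: sume_ge0 => l _; rewrite mule_ge0 ?lee_fin.
  apply: lee_wpmul2l; first by rewrite lee_fin.
  rewrite /g clipped0_cell; last 2 first.
  - by rewrite mulr1 ltW.
  - by rewrite ler_pM2l// ler_nat.
  have -> : u * delta = u * 1 * (delta * 2%:R - delta * 1%:R).
    by rewrite mulr1 -mulrBr -natrB// mulr1.
  apply: zeta_intensity_ge => //; first by rewrite ler_pM2l// ler_nat.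
  move=> x /andP[x0 _]; rewrite -[leLHS]expR0 ler_expR le_min lexx /=.
  by apply: le_trans x0; rewrite mulr1 ltW.
have Sn n : ((k0 * (1 + eps) ^+ n)%:E <= S n)%E.
  elim: n => [|n IH]; first by rewrite expr0 mulr1.
  apply: le_trans (SS n).
  rewrite exprS mulrCA EFinM; apply: lee_wpmul2l => //.
  by rewrite lee_fin; lra.
(* A lower bound for the kernel from any cell [l < L] into cell 0, divided by [L] because
   [f l <= L]. *)
pose k1 := u * (delta - eta) * expR (- (delta * L%:R)) / L%:R.
have L0 : 0 < L%:R :> R by rewrite ltr0n ltnW.
have k10 : 0 < k1.
  by rewrite !mulr_gt0 ?expR_gt0 ?invr_gt0// subr_gt0.
exists (k1 * k0), eps; split => //; first exact: mulr_gt0.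
move=> n; apply: (@le_trans _ _ (g n.+1 0%N)); last first.
  apply: X_clipped_ge; first exact: measurable_itv.
  move=> x /=; rewrite !in_itv /= mulr0 mulr1 => /andP[-> xd] /=.
  exact: le_trans (ltW xd) dr.
apply: le_trans (step n 0%N).
rewrite -mulrA EFinM; apply: (@le_trans _ _ (k1%:E * S n)%E).
  by apply: lee_wpmul2l => //; rewrite lee_fin ltW.
rewrite /S ge0_sume_distrr; last by move=> l _; rewrite mule_ge0 ?lee_fin.
apply: lee_sum => l _; rewrite muleA -EFinM lee_wpmul2r// lee_fin.
rewrite /k1 /c subn0 -[leLHS]mulrA [_^-1 * _]mulrC.
apply: (@le_trans _ _ (u * (delta - eta) * expR (- (delta * L%:R)))).
  rewrite -[leRHS]mulr1; apply: ler_wpM2l.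
    by rewrite mulr_ge0 ?expR_ge0// mulr_ge0 ?(ltW u0)// subr_ge0 ltW.
  rewrite ler_pdivrMr// mul1r.
  rewrite -[leRHS]mul1r; apply: ler_pM; rewrite ?expR_ge0 ?ler0n//.
    by rewrite -[leRHS]expR0 ler_expR oppr_le0 divr_ge0// mulr_ge0// ltW.
  by rewrite ler_nat /tent; exact: leq_trans (geq_minl _ _) (ltnW (ltn_ord l)).
apply: ler_wpM2l; first by rewrite mulr_ge0 ?(ltW u0)// subr_ge0 ltW.
by rewrite ler_expR lerN2 ler_pM2l// ler_nat ltn_ord.
Qed.

End process.

(** * The two regimes of the theorem *)

Lemma bernoulli_ineq (R : realType) (eps : R) n : 0 <= eps -> 1 + n%:R * eps <=
  (1 + eps) ^+ n.
Proof.
move=> e0; elim: n => [|n IH]; first by rewrite mul0r addr0 expr0.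
rewrite exprS -natr1.
have : 0 <= n%:R :> R by rewrite ler0n.
nra.
Qed.

Theorem theorem1p4 (R : realType) :
  (exists C : R, forall u r : R, 0 < u < 1 / 4 -> 0 <= r ->
     forall (d : measure_display) (T : measurableType d) (P : probability T R)
       (xi0 : T -> set R) (xi : nat -> nat -> T -> set R),
     iid_poisson_family P u xi0 xi ->
     (\sum_(1 <= n <oo) \int[P]_w X xi0 xi n 0%R r w
        < (C * (expR (4 * u * r) / (1 - 4 * u)))%:E < +oo)%E) /\
  (forall u r : R, 1 / 4 < u -> 0 < r ->
     forall (d : measure_display) (T : measurableType d) (P : probability T R)
       (xi0 : T -> set R) (xi : nat -> nat -> T -> set R),
     iid_poisson_family P u xi0 xi ->
     (fun n => (\int[P]_w X xi0 xi n 0%R r w)%E) @ \oo --> +oo%E).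
Proof.
split.
  (* The geometric series has gap [1 - c = (1 - 4 * u) / 4], which yields the constant 4; taking 5
     makes the inequality strict. *)
  exists 5 => u r /andP[u0 u4] r0 d T P xi0 xi iid; rewrite ltry andbT.
  have [eta e0 bnd] := subcritical_bound u0 u4.
  have t0 : 0 < 1 - 4 * u by lra.
  set c := 1 - (1 - 4 * u) / 4 in bnd.
  have c0 : 0 <= c by rewrite /c; lra.
  have c1 : c < 1 by rewrite /c; lra.
  have a0 : 0 < 2 * u by lra.
  have X0 n : (0 <= \int[P]_w X xi0 xi n 0%R r w)%E.
    by apply: integral_ge0 => w _; exact: counting_ge0.
  have Xn n : (\int[P]_w X xi0 xi n.+1 0%R r w <=
    (expR (2 * u * r) * c ^+ n.+1)%:E)%E.
    apply: (le_trans (X_clipped_le u0 iid r n a0)).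
    rewrite EFinM; apply: lee_wpmul2l; first by rewrite lee_fin expR_ge0.
    exact: (integral_exp_sum_clipped u0 iid a0 e0).
  apply: (@le_lt_trans _ _ (4 * (expR (2 * u * r) / (1 - 4 * u)))%:E); last first.
    rewrite lte_fin !mulrA ltr_pM2r ?invr_gt0//.
    have : expR (2 * u * r) <= expR (4 * u * r) by rewrite ler_expR; nra.
    have := expR_gt0 (4 * u * r); lra.
  rewrite -[1%N]add0n -nneseries_addn//.
  apply: lime_le; first by apply: is_cvg_nneseries.
  apply: nearW => n.
  apply: (@le_trans _ _ (\sum_(0 <= i < n) (expR (2 * u * r) * c ^+ i.+1)%:E)%E).
    by apply: lee_sum => i _; rewrite add0n addn1; exact: Xn.
  rewrite sumEFin lee_fin -mulr_sumr mulrCA ler_wpM2l ?expR_ge0//.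
  under eq_bigr do rewrite exprS.
  rewrite -mulr_sumr; apply: (@le_trans _ _ (1 - c)^-1).
    rewrite -[leRHS]mul1r; apply: ler_pM => //; last exact: geometric_sum_le.
      by apply: sumr_ge0 => i _; exact: exprn_ge0.
    exact: ltW.
  by rewrite /c opprB addrCA subrr addr0 invf_div.
move=> u r u4 r0 d T P xi0 xi iid.
have u0 : 0 < u by lra.
have [K [eps [K0 e0 KX]]] := supercritical_growth u0 iid u4 r0.
apply/cvgeyPge => A.
(* Two of the three units absorb the shift to generation [n.+2]; the third rounds the threshold
   up. *)
exists (Num.truncn (`|A| / (K * eps))).+3 => // n /= nN.
case: n nN => [//|[//|n]] nN.
apply: le_trans (KX n); rewrite lee_fin.
apply: (@le_trans _ _ (K * (1 + n%:R * eps))); last first.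
  by rewrite ler_pM2l//; apply: bernoulli_ineq; exact: ltW.
apply: (le_trans (ler_norm _)).
have : `|A| / (K * eps) < n%:R.
  by apply: (lt_le_trans (truncnS_gt _)); rewrite ler_nat.
rewrite ltr_pdivrMr ?mulr_gt0//; nra.
Qed.
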